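(* Let $K$ be a field and let $H$ be a Hopf subalgebra of a bialgebra $E$ over $K$. Assume that $H$ is formally smooth as a coalgebra in $\mathfrak{M}_{K}$ and that $\mathrm{Corad}(E)\subseteq H$. Then $E$ has a weak projection onto $H$.
   Context: $\mathfrak{M}_K$ is the category of $K$-vector spaces; $\mathrm{Corad}(E)$ is the coradical of $E$ (the sum of its simple subcoalgebras). A weak projection of $E$ onto a Hopf subalgebra $H$ is a retraction $\pi:E\to H$ of the inclusion map ($\pi|_H=\mathrm{Id}_H$) which is a left $H$-linear coalgebra map. A $K$-coalgebra $(C,\Delta,\varepsilon)$ is formally smooth as a coalgebra in $\mathfrak{M}_K$ if the $C$-bicomodule $\mho_1C=\mathrm{Coker}\,\Delta$ is injective relative to those $C$-bicomodule morphisms that have a $K$-linear retraction (since $K$ is a field, equivalently it is an injective $C$-bicomodule). *)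

(* Defs.v *)
From HB Require Import structures.
From mathcomp Require Import all_boot all_order all_algebra.
From mathcomp Require Import boolp classical_sets freeg.

Set Implicit Arguments.
Unset Strict Implicit.
Unset Printing Implicit Defensive.

Import GRing.Theory.

Local Open Scope classical_set_scope.
Local Open Scope ring_scope.
Local Open Scope quotient_scope.

Reserved Notation "U \ox V" (at level 40, left associativity).

Section Submodules.
Variables (K : fieldType) (V : lmodType K).

Definition is_submod (D : set V) : Prop := GRing.submod_closed [in D].

Lemma is_submodP (D : set V) :
  is_submod D <-> D 0 /\ forall a x y, D x -> D y -> D (a *: x + y).
Proof.
split=> [[D0 DZ]|[D0 DZ]].
  split=> [|a x y]; first by move: D0; rewrite in_setE.
  by move=> /mem_set Dx /mem_set Dy; apply/set_mem/DZ.
split=> [|a x y]; first by rewrite in_setE.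
by rewrite !in_setE; apply: DZ.
Qed.

Definition span (S : set V) : set V := smallest is_submod S.

Lemma span_submod S : is_submod (span S).
Proof.
apply/is_submodP; split=> [D [/is_submodP[]]//|a x y xS yS D DS].
by have [/is_submodP[_ DZ] _] := DS; apply: DZ; [exact: xS|exact: yS].
Qed.

Lemma sub_span S : S `<=` span S.
Proof. exact: sub_gen_smallest. Qed.

Lemma span_sub (S D : set V) : is_submod D -> S `<=` D -> span S `<=` D.
Proof. exact: smallest_sub. Qed.

Definition spanb (S : set V) : {pred V} := [in span S].

HB.instance Definition _ (S : set V) :=
  GRing.isSubmodClosed.Build K V (spanb S)
    (GRing.submod_closed_semi (span_submod S)).

End Submodules.

(* The quotient of [V] by the subspace spanned by [S]. *)
Definition quot (K : fieldType) (V : lmodType K) (S : set V) : Type :=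
  Quotient.quot (spanb S).

Section Quot.
Variables (K : fieldType) (V : lmodType K) (S : set V).

HB.instance Definition _ := GRing.Zmodule.on (quot S).

Definition qpi (x : V) : quot S := \pi_(Quotient.quot (spanb S)) x.

Lemma qpi_surj (y : quot S) : exists x, y = qpi x.
Proof. by exists (repr (y : Quotient.quot (spanb S))); rewrite /qpi reprK. Qed.

Lemma qpi_eq x y : qpi x = qpi y <-> span S (x - y).
Proof.
have E : (qpi x == qpi y) = (x - y \in spanb S) by rewrite Quotient.idealrBE.
by split=> [/eqP|h]; [rewrite E => /set_mem|apply/eqP; rewrite E; apply/mem_set].
Qed.

Lemma qpi_is_zmod_morphism : zmod_morphism qpi.
Proof.
by move=> x y; rewrite /qpi [LHS]pi_addr [in LHS]pi_oppr.
Qed.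

HB.instance Definition _ :=
  GRing.isZmodMorphism.Build V (quot S) qpi qpi_is_zmod_morphism.

Definition qscale (a : K) (y : quot S) : quot S :=
  qpi (a *: repr (y : Quotient.quot (spanb S))).

Lemma qscale_pi a x : qscale a (qpi x) = qpi (a *: x).
Proof.
apply/qpi_eq; rewrite -scalerBr; have /is_submodP[S0 SZ] := span_submod S.
rewrite -[_ *: _]addr0; apply: SZ => //; apply/qpi_eq.
by rewrite /qpi reprK.
Qed.

Lemma qscaleA a b y : qscale a (qscale b y) = qscale (a * b) y.
Proof. by have [x ->] := qpi_surj y; rewrite !qscale_pi scalerA. Qed.

Lemma qscale1 : left_id 1 qscale.
Proof. by move=> y; have [x ->] := qpi_surj y; rewrite qscale_pi scale1r. Qed.

Lemma qscaleDr : right_distributive qscale +%R.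
Proof.
move=> a y z; have [x ->] := qpi_surj y; have [x' ->] := qpi_surj z.
by rewrite -raddfD !qscale_pi scalerDr raddfD.
Qed.

Lemma qscaleDl y : {morph qscale^~ y : a b / a + b}.
Proof.
move=> a b; have [x ->] := qpi_surj y.
by rewrite !qscale_pi scalerDl raddfD.
Qed.

HB.instance Definition _ := GRing.Zmodule_isLmodule.Build K (quot S)
  qscaleA qscale1 qscaleDr qscaleDl.

Lemma qpi_is_scalable : scalable qpi.
Proof. by move=> a x; rewrite -qscale_pi. Qed.

HB.instance Definition _ :=
  GRing.isScalable.Build K V (quot S) *:%R qpi qpi_is_scalable.

Section Lift.
Variables (W : lmodType K) (f : {linear V -> W}).

Definition qlift (_ : forall x, S x -> f x = 0) : quot S -> W := fun y =>
  f (repr (y : Quotient.quot (spanb S))).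

Hypothesis fS : forall x, S x -> f x = 0.

Lemma qlift_pi x : qlift fS (qpi x) = f x.
Proof.
apply/eqP; rewrite /qlift -subr_eq0 -linearB; apply/eqP.
apply: (@span_sub K V S (fun x => f x = 0) _ fS).
  apply/is_submodP; split; first exact: linear0.
  by move=> a u v fu fv; rewrite linearP fu fv scaler0 addr0.
by apply/qpi_eq; rewrite /qpi reprK.
Qed.

Lemma qlift_is_linear : linear (qlift fS).
Proof.
move=> a y z; have [x ->] := qpi_surj y; have [x' ->] := qpi_surj z.
by rewrite -linearP !qlift_pi linearP.
Qed.

HB.instance Definition _ :=
  GRing.isLinear.Build K (quot S) W *:%R (qlift fS) qlift_is_linear.

End Lift.
End Quot.

Section Tensor.
Variables (K : fieldType) (U V : lmodType K).

Definition tensor_rel : set {freeg (U * V) / K} :=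
  [set r | exists a u u' v,
     r = << (a *: u + u', v) >> - a *: << (u, v) >> - << (u', v) >>] `|`
  [set r | exists a u v v',
     r = << (u, a *: v + v') >> - a *: << (u, v) >> - << (u, v') >>].

Definition tensor : Type := quot tensor_rel.

HB.instance Definition _ := GRing.Lmodule.on tensor.

Definition tens (u : U) (v : V) : tensor := qpi tensor_rel << (u, v) >>.

Lemma tens_bilinear : bilinear_for *:%R *:%R tens.
Proof.
split=> [v a u u'|u a v v']; rewrite /tens -linearP.
  by apply/qpi_eq; apply: sub_span; left; exists a, u, u', v; rewrite opprD addrA.
by apply/qpi_eq; apply: sub_span; right; exists a, u, v, v'; rewrite opprD addrA.
Qed.

Lemma tensPl a u u' v : tens (a *: u + u') v = a *: tens u v + tens u' v.
Proof. exact: tens_bilinear.1. Qed.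

Lemma tensPr a u v v' : tens u (a *: v + v') = a *: tens u v + tens u v'.
Proof. exact: tens_bilinear.2. Qed.

Lemma tensDl u u' v : tens (u + u') v = tens u v + tens u' v.
Proof. by have := tensPl 1 u u' v; rewrite !scale1r. Qed.

Lemma tensDr u v v' : tens u (v + v') = tens u v + tens u v'.
Proof. by have := tensPr 1 u v v'; rewrite !scale1r. Qed.

Lemma tens0l v : tens 0 v = 0.
Proof. by apply: (addrI (tens 0 v)); rewrite -tensDl !addr0. Qed.

Lemma tens0r u : tens u 0 = 0.
Proof. by apply: (addrI (tens u 0)); rewrite -tensDr !addr0. Qed.

Lemma tensZl a u v : tens (a *: u) v = a *: tens u v.
Proof. by have := tensPl a u 0 v; rewrite tens0l !addr0. Qed.

Lemma tensZr a u v : tens u (a *: v) = a *: tens u v.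
Proof. by have := tensPr a u v 0; rewrite tens0r !addr0. Qed.

Lemma tens_ind (P : tensor -> Prop) :
  (forall u v, P (tens u v)) -> (forall s t, P s -> P t -> P (s + t)) ->
  forall t, P t.
Proof.
move=> Ptens PD t; have [x ->] := qpi_surj t.
rewrite -(freeg_sumE x) linear_sum /=.
have P0 : P 0 by rewrite -(tens0l 0).
elim/big_ind: _ => // -[u v] _.
have -> : << coeff (u, v) x *g (u, v) >> = coeff (u, v) x *: << (u, v) >>.
  apply/eqP/freeg_eqP => z; by rewrite coeffZ !coeffU mul1r.
by rewrite linearZ /= -[qpi _ _]/(tens u v) -tensZl.
Qed.

Section Lift.
Variables (W : lmodType K) (f : U -> V -> W).
Hypothesis bf : bilinear_for *:%R *:%R f.

Definition freelift : {freeg (U * V) / K} -> W := fglift (fun p => f p.1 p.2).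

Lemma freelift_is_linear : linear freelift.
Proof.
have fB := @lift_is_additive K _ W (fun p : U * V => f p.1 p.2).
pose F := GRing.isZmodMorphism.Build _ _ freelift fB.
pose g : {additive {freeg (U * V) / K} -> W} := HB.pack freelift F.
have gD x y : freelift (x + y) = freelift x + freelift y by exact: (raddfD g).
have gS (h : U * V -> {freeg (U * V) / K}) s :
    freelift (\sum_(p <- s) h p) = \sum_(p <- s) freelift (h p).
  exact: (raddf_sum g).
move=> a x y; rewrite gD; congr (_ + _).
rewrite -(freeg_sumE x) scaler_sumr !gS scaler_sumr.
apply: eq_bigr => p _; rewrite /freelift.
have -> : a *: << coeff p x *g p >> = << a * coeff p x *g p >>.
  by apply/eqP/freeg_eqP => z; rewrite coeffZ !coeffU mulrA.
by rewrite !liftU scalerA.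
Qed.

HB.instance Definition _ := GRing.isLinear.Build K {freeg (U * V) / K} W
  *:%R freelift freelift_is_linear.

Lemma freelift_rel x : tensor_rel x -> freelift x = 0.
Proof.
have fU u v : freelift << (u, v) >> = f u v by rewrite /freelift liftU scale1r.
case=> [[a [u [u' [v ->]]]]|[a [u [v [v' ->]]]]];
  rewrite !linearB linearZ /= !fU.
  by rewrite bf.1 addrAC addrK subrr.
by rewrite bf.2 addrAC addrK subrr.
Qed.

End Lift.

Section LiftDef.
Variables (W : lmodType K) (f : U -> V -> W).
Variable bf : bilinear_for *:%R *:%R f.

(* The linear map [U \ox V -> W] induced by the bilinear map [f]. *)
Definition tlift : tensor -> W := qlift (freelift_rel bf).

HB.instance Definition _ := GRing.Linear.on tlift.

Lemma tliftE u v : tlift (tens u v) = f u v.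
Proof. by rewrite /tlift [LHS]qlift_pi /= /freelift liftU scale1r. Qed.

Lemma tliftD s t : tlift (s + t) = tlift s + tlift t.
Proof. exact: linearD. Qed.

End LiftDef.
End Tensor.

Notation "U \ox V" := (tensor U%type V%type) : type_scope.
Notation "u \ox v" := (tens u v) : ring_scope.

Section TensorMaps.
Variable K : fieldType.

Section Tmap.
Variables (U U' V V' : lmodType K) (f : {linear U -> U'}) (g : {linear V -> V'}).

Lemma tmap_bilinear : bilinear_for *:%R *:%R (fun u v => f u \ox g v).
Proof. by split=> [v a u u'|u a v v'] /=; rewrite linearP (tensPl, tensPr). Qed.

Definition tmap : U \ox V -> U' \ox V' := tlift tmap_bilinear.

HB.instance Definition _ := GRing.Linear.on tmap.

Lemma tmapE u v : tmap (u \ox v) = f u \ox g v.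
Proof. exact: tliftE. Qed.

Lemma tmapD s t : tmap (s + t) = tmap s + tmap t.
Proof. exact: linearD. Qed.

End Tmap.

Section Assoc.
Variables U V W : lmodType K.

Lemma tassoc_bilinear1 (w : W) :
  bilinear_for *:%R *:%R (fun (u : U) (v : V) => u \ox (v \ox w)).
Proof. by split=> [v a u u'|u a v v'] /=; rewrite !(tensPl, tensPr). Qed.

Lemma tassoc_bilinear :
  bilinear_for *:%R *:%R (fun t w => tlift (tassoc_bilinear1 w) t).
Proof.
split=> [w a s t|t a w w'] /=; first exact: linearP.
elim/tens_ind: t => [u v|s t IHs IHt]; first by rewrite !tliftE !tensPr.
by rewrite !tliftD IHs IHt scalerDr addrACA.
Qed.

Definition tassoc : (U \ox V) \ox W -> U \ox (V \ox W) := tlift tassoc_bilinear.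

HB.instance Definition _ := GRing.Linear.on tassoc.

Lemma tassocE u v w : tassoc ((u \ox v) \ox w) = u \ox (v \ox w).
Proof. by rewrite /tassoc !tliftE. Qed.

Lemma tassocD s t : tassoc (s + t) = tassoc s + tassoc t.
Proof. exact: linearD. Qed.

Lemma tassocV_bilinear1 (u : U) :
  bilinear_for *:%R *:%R (fun (v : V) (w : W) => (u \ox v) \ox w).
Proof. by split=> [w a v v'|v a w w'] /=; rewrite !(tensPl, tensPr). Qed.

Lemma tassocV_bilinear :
  bilinear_for *:%R *:%R (fun u t => tlift (tassocV_bilinear1 u) t).
Proof.
split=> [t a u u'|u a s t] /=; last exact: linearP.
elim/tens_ind: t => [v w|s t IHs IHt]; first by rewrite !tliftE !tensPl.
by rewrite !tliftD IHs IHt scalerDr addrACA.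
Qed.

Definition tassocV : U \ox (V \ox W) -> (U \ox V) \ox W := tlift tassocV_bilinear.

HB.instance Definition _ := GRing.Linear.on tassocV.

Lemma tassocVE u v w : tassocV (u \ox (v \ox w)) = (u \ox v) \ox w.
Proof. by rewrite /tassocV !tliftE. Qed.

Lemma tassocVD s t : tassocV (s + t) = tassocV s + tassocV t.
Proof. exact: linearD. Qed.

Lemma tassocK : cancel tassoc tassocV.
Proof.
elim/tens_ind=> [t w|s t IHs IHt]; last by rewrite tassocD tassocVD IHs IHt.
elim/tens_ind: t => [u v|s t IHs IHt]; first by rewrite tassocE tassocVE.
by rewrite tensDl tassocD tassocVD IHs IHt.
Qed.

End Assoc.

Section Unitors.
Variable V : lmodType K.

Lemma tlunit_bilinear : bilinear_for *:%R *:%R (fun (a : K^o) (v : V) => a *: v).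
Proof.
split=> [v a b c|b a v w] /=; first by rewrite scalerDl -scalerA.
by rewrite scalerDr !scalerA mulrC.
Qed.

Definition tlunit : K^o \ox V -> V := tlift tlunit_bilinear.

HB.instance Definition _ := GRing.Linear.on tlunit.

Lemma tlunitE a v : tlunit (a \ox v) = a *: v.
Proof. exact: tliftE. Qed.

Lemma tlunitD s t : tlunit (s + t) = tlunit s + tlunit t.
Proof. exact: linearD. Qed.

Lemma trunit_bilinear : bilinear_for *:%R *:%R (fun (v : V) (a : K^o) => a *: v).
Proof. by split=> *; case: tlunit_bilinear => bl br; [apply: br|apply: bl]. Qed.

Definition trunit : V \ox K^o -> V := tlift trunit_bilinear.

HB.instance Definition _ := GRing.Linear.on trunit.

Lemma trunitE a v : trunit (v \ox a) = a *: v.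
Proof. exact: tliftE. Qed.

Lemma trunitD s t : trunit (s + t) = trunit s + trunit t.
Proof. exact: linearD. Qed.

End Unitors.

Definition tensorD := (tensDl, tensDr, tmapD, tassocD, tassocVD, tlunitD, trunitD).
Definition tensorE := (tmapE, tassocE, tassocVE, tlunitE, trunitE).

Section AlgebraTensor.
Variable A : algType K.

Lemma tprod_bilinear : bilinear_for *:%R *:%R (fun a b : A => a * b).
Proof.
split=> [b k a a'|a k b b'] /=; first by rewrite mulrDl scalerAl.
by rewrite mulrDr scalerAr.
Qed.

Definition tprod : A \ox A -> A := tlift tprod_bilinear.

HB.instance Definition _ := GRing.Linear.on tprod.

Lemma tprodE a b : tprod (a \ox b) = a * b.
Proof. exact: tliftE. Qed.

Lemma tmul_bilinear1 (a b : A) :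
  bilinear_for *:%R *:%R (fun c d : A => (a * c) \ox (b * d)).
Proof.
split=> [d k c c'|c k d d'] /=;
  by rewrite mulrDr -scalerAr (tensPl, tensPr).
Qed.

Lemma tmul_bilinear (t : A \ox A) :
  bilinear_for *:%R *:%R (fun a b : A => tlift (tmul_bilinear1 a b) t).
Proof.
split=> [b k a a'|a k b b'] /=; elim/tens_ind: t => [c d|s t IHs IHt];
  rewrite ?tliftE ?tliftD ?IHs ?IHt ?scalerDr 1?addrACA //;
  by rewrite mulrDl -scalerAl (tensPl, tensPr).
Qed.

(* The product of the algebra [A \ox A]. *)
Definition tmul (s t : A \ox A) : A \ox A := tlift (tmul_bilinear t) s.

Lemma tmulE a b c d : tmul (a \ox b) (c \ox d) = (a * c) \ox (b * d).
Proof. by rewrite /tmul !tliftE. Qed.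

End AlgebraTensor.
End TensorMaps.

HB.mixin Record Lmodule_isCoalgebra (K : fieldType) C of GRing.Lmodule K C := {
  comul : {linear C -> (C \ox C)%type};
  counit : {linear C -> K^o};
  comulA : forall c, tassoc (tmap comul idfun (comul c)) =
                     tmap idfun comul (comul c);
  comul_counitl : forall c, tlunit (tmap counit idfun (comul c)) = c;
  comul_counitr : forall c, trunit (tmap idfun counit (comul c)) = c
}.

#[short(type="coalgType")]
HB.structure Definition Coalgebra (K : fieldType) :=
  {C of GRing.Lmodule K C & Lmodule_isCoalgebra K C}.

HB.mixin Record Coalgebra_isBialgebra (K : fieldType) E
    of GRing.Algebra K E & Coalgebra K E := {
  comul1 : comul (1 : E) = 1 \ox 1;
  comulM : forall x y : E, comul (x * y) = tmul (comul x) (comul y);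
  counit1 : counit (1 : E) = 1;
  counitM : forall x y : E, counit (x * y) = (counit x : K) * counit y
}.

#[short(type="bialgType")]
HB.structure Definition Bialgebra (K : fieldType) :=
  {E of GRing.Algebra K E & Coalgebra K E & Coalgebra_isBialgebra K E}.

HB.mixin Record Bialgebra_isHopf (K : fieldType) H of Bialgebra K H := {
  antipode : {linear H -> H};
  antipodel : forall h : H,
    tprod (tmap antipode idfun (comul h)) = counit h *: 1;
  antipoder : forall h : H,
    tprod (tmap idfun antipode (comul h)) = counit h *: 1
}.

#[short(type="hopfAlgType")]
HB.structure Definition HopfAlgebra (K : fieldType) :=
  {H of Bialgebra K H & Bialgebra_isHopf K H}.

Section CoalgebraMorphism.
Variables (K : fieldType) (C D : coalgType K).

Definition coalg_morphism (f : {linear C -> D}) : Prop :=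
  (forall c, comul (f c) = tmap f f (comul c)) /\
  (forall c, counit (f c) = counit c).

End CoalgebraMorphism.

HB.mixin Record isSubCoalgebra (K : fieldType) (C : coalgType K) (S : pred C) D
    of @GRing.SubLmodule K C S D & Coalgebra K D := {
  val_coalg_morphism : @coalg_morphism K D C (val : D -> C)
}.

(* A Hopf subalgebra of [E]: a Hopf algebra structure on the subset [S] whose
   inclusion [val] is a morphism of algebras and of coalgebras. *)
#[short(type="subHopfAlgType")]
HB.structure Definition SubHopfAlgebra (K : fieldType) (E : bialgType K)
    (S : pred E) :=
  {H of @GRing.SubAlgebra K E S H & HopfAlgebra K H & isSubCoalgebra K E S H}.

Section Coradical.
Variables (K : fieldType) (C : coalgType K).

Definition subcoalgebra (D : set C) : Prop :=
  is_submod D /\ (D `<=` comul @^-1` span [set x \ox y | x in D & y in D]).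

Definition simple_subcoalgebra (D : set C) : Prop :=
  [/\ subcoalgebra D, D <> [set 0] &
      forall D', subcoalgebra D' -> D' `<=` D -> D' = [set 0] \/ D' = D].

Definition corad : set C := span (\bigcup_(D in simple_subcoalgebra) D).

End Coradical.

Arguments corad {K} C.

HB.mixin Record Lmodule_isBicomodule (K : fieldType) (C : coalgType K) M
    of GRing.Lmodule K M := {
  lcoact : {linear M -> (C \ox M)%type};
  rcoact : {linear M -> (M \ox C)%type};
  lcoactA : forall m, tassoc (tmap comul idfun (lcoact m)) =
                      tmap idfun lcoact (lcoact m);
  lcoact_counit : forall m, tlunit (tmap counit idfun (lcoact m)) = m;
  rcoactA : forall m, tassoc (tmap rcoact idfun (rcoact m)) =
                      tmap idfun comul (rcoact m);
  rcoact_counit : forall m, trunit (tmap idfun counit (rcoact m)) = m;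
  lrcoactA : forall m, tassoc (tmap lcoact idfun (rcoact m)) =
                       tmap idfun rcoact (lcoact m)
}.

#[short(type="bicomodType")]
HB.structure Definition Bicomodule (K : fieldType) (C : coalgType K) :=
  {M of GRing.Lmodule K M & Lmodule_isBicomodule K C M}.

Section BicomoduleMorphism.
Variables (K : fieldType) (C : coalgType K) (M N : bicomodType C).

Definition bicomod_morphism (f : {linear M -> N}) : Prop :=
  (forall m, lcoact (f m) = tmap idfun f (lcoact m)) /\
  (forall m, rcoact (f m) = tmap f idfun (rcoact m)).

End BicomoduleMorphism.

Section QuotientBicomodule.
Variables (K : fieldType) (C : coalgType K) (M : bicomodType C) (N : lmodType K).
Variables (q : {linear M -> N}) (l : {linear N -> (C \ox N)%type})
  (r : {linear N -> (N \ox C)%type}).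
Hypothesis q_surj : forall n, exists m, n = q m.
Hypothesis lq : forall m, l (q m) = tmap idfun q (lcoact m).
Hypothesis rq : forall m, r (q m) = tmap q idfun (rcoact m).

Lemma quot_lcoactA n : tassoc (tmap comul idfun (l n)) = tmap idfun l (l n).
Proof.
have [m ->] := q_surj n; rewrite lq.
have -> : tmap idfun l (tmap idfun q (lcoact m)) =
          tmap idfun (tmap idfun q) (tmap idfun lcoact (lcoact m)).
  elim/tens_ind: (lcoact m) => [c x|s t IHs IHt]; first by rewrite !tensorE /= ?tensorE lq.
  by rewrite !tensorD IHs IHt.
rewrite -lcoactA; elim/tens_ind: (lcoact m) => [c x|s t IHs IHt]; last first.
  by rewrite !tensorD IHs IHt.
rewrite !tensorE /= ?tensorE; elim/tens_ind: (comul c) => [a b|s t IHs IHt].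
  by rewrite !tensorE /= ?tensorE.
by rewrite !tensorD IHs IHt.
Qed.

Lemma quot_lcoact_counit n : tlunit (tmap counit idfun (l n)) = n.
Proof.
have [m ->] := q_surj n; rewrite lq -[in RHS](lcoact_counit m).
elim/tens_ind: (lcoact m) => [c x|s t IHs IHt].
  by rewrite !tensorE /= ?tensorE linearZ.
by rewrite !tensorD IHs IHt linearD.
Qed.

Lemma quot_rcoactA n : tassoc (tmap r idfun (r n)) = tmap idfun comul (r n).
Proof.
have [m ->] := q_surj n; rewrite rq.
have -> : tmap idfun comul (tmap q idfun (rcoact m)) =
          tmap q idfun (tmap idfun comul (rcoact m)).
  elim/tens_ind: (rcoact m) => [x c|s t IHs IHt]; first by rewrite !tensorE /= ?tensorE.
  by rewrite !tensorD IHs IHt.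
rewrite -rcoactA; elim/tens_ind: (rcoact m) => [x c|s t IHs IHt]; last first.
  by rewrite !tensorD IHs IHt.
rewrite !tensorE /= ?tensorE rq; elim/tens_ind: (rcoact x) => [a b|s t IHs IHt].
  by rewrite !tensorE /= ?tensorE.
by rewrite !tensorD IHs IHt.
Qed.

Lemma quot_rcoact_counit n : trunit (tmap idfun counit (r n)) = n.
Proof.
have [m ->] := q_surj n; rewrite rq -[in RHS](rcoact_counit m).
elim/tens_ind: (rcoact m) => [x c|s t IHs IHt].
  by rewrite !tensorE /= ?tensorE linearZ.
by rewrite !tensorD IHs IHt linearD.
Qed.

Lemma quot_lrcoactA n : tassoc (tmap l idfun (r n)) = tmap idfun r (l n).
Proof.
have [m ->] := q_surj n; rewrite lq rq.
have -> : tmap idfun r (tmap idfun q (lcoact m)) =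
          tmap idfun (tmap q idfun) (tmap idfun rcoact (lcoact m)).
  elim/tens_ind: (lcoact m) => [c x|s t IHs IHt]; first by rewrite !tensorE /= ?tensorE rq.
  by rewrite !tensorD IHs IHt.
rewrite -lrcoactA; elim/tens_ind: (rcoact m) => [x c|s t IHs IHt]; last first.
  by rewrite !tensorD IHs IHt.
rewrite !tensorE /= ?tensorE lq; elim/tens_ind: (lcoact x) => [a b|s t IHs IHt].
  by rewrite !tensorE /= ?tensorE.
by rewrite !tensorD IHs IHt.
Qed.

End QuotientBicomodule.

Section CofreeBicomodule.
Variables (K : fieldType) (C : coalgType K).

Definition cofree_lcoact : C \ox C -> C \ox (C \ox C) :=
  @tassoc K C C C \o tmap comul idfun.

Definition cofree_rcoact : C \ox C -> (C \ox C) \ox C :=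
  @tassocV K C C C \o tmap idfun comul.

HB.instance Definition _ := GRing.Linear.on cofree_lcoact.
HB.instance Definition _ := GRing.Linear.on cofree_rcoact.

Lemma cofree_lcoactE c d : cofree_lcoact (c \ox d) = tassoc (comul c \ox d).
Proof. by rewrite /cofree_lcoact /= tmapE. Qed.

Lemma cofree_rcoactE c d : cofree_rcoact (c \ox d) = tassocV (c \ox comul d).
Proof. by rewrite /cofree_rcoact /= tmapE. Qed.

Lemma cofree_lcoactD s t :
  cofree_lcoact (s + t) = cofree_lcoact s + cofree_lcoact t.
Proof. exact: linearD. Qed.

Lemma cofree_rcoactD s t :
  cofree_rcoact (s + t) = cofree_rcoact s + cofree_rcoact t.
Proof. exact: linearD. Qed.

Lemma cofree_lcoactA t : tassoc (tmap comul idfun (cofree_lcoact t)) =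
  tmap idfun cofree_lcoact (cofree_lcoact t).
Proof.
elim/tens_ind: t => [c d|s t IHs IHt]; last first.
  by rewrite cofree_lcoactD !tensorD IHs IHt.
rewrite !cofree_lcoactE.
transitivity (tmap idfun (@tassoc K C C C) (tassoc (tmap idfun comul (comul c) \ox d))).
  rewrite -comulA; elim/tens_ind: (comul c) => [a b|s t IHs IHt]; last first.
    by rewrite !tensorD IHs IHt.
  rewrite !tensorE /= ?tensorE; elim/tens_ind: (comul a) => [x y|s t IHs IHt].
    by rewrite !tensorE /= ?tensorE.
  by rewrite !tensorD IHs IHt.
elim/tens_ind: (comul c) => [a b|s t IHs IHt]; last first.
  by rewrite !tensorD IHs IHt.
by rewrite !tensorE /= ?tensorE cofree_lcoactE.
Qed.

Lemma cofree_lcoact_counit t : tlunit (tmap counit idfun (cofree_lcoact t)) = t.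
Proof.
elim/tens_ind: t => [c d|s t IHs IHt]; last first.
  by rewrite cofree_lcoactD !tensorD IHs IHt.
rewrite cofree_lcoactE -[in RHS](comul_counitl c).
elim/tens_ind: (comul c) => [a b|s t IHs IHt]; first by rewrite !tensorE /= ?tensorE tensZl.
by rewrite !tensorD IHs IHt.
Qed.

Lemma cofree_rcoactA t : tassoc (tmap cofree_rcoact idfun (cofree_rcoact t)) =
  tmap idfun comul (cofree_rcoact t).
Proof.
elim/tens_ind: t => [c d|s t IHs IHt]; last first.
  by rewrite cofree_rcoactD !tensorD IHs IHt.
rewrite !cofree_rcoactE.
transitivity (tassoc (tmap (@tassocV K C C C) idfun
  (tassocV (c \ox tmap comul idfun (comul d))))).
  elim/tens_ind: (comul d) => [a b|s t IHs IHt]; last first.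
    by rewrite !tensorD IHs IHt.
  by rewrite !tensorE /= ?tensorE cofree_rcoactE.
have -> : tmap comul idfun (comul d) = tassocV (tmap idfun comul (comul d)).
  exact: (etrans (esym (tassocK _)) (congr1 (@tassocV K C C C) (comulA d))).
elim/tens_ind: (comul d) => [a b|s t IHs IHt]; last first.
  by rewrite !tensorD IHs IHt.
rewrite !tensorE /= ?tensorE; elim/tens_ind: (comul b) => [x y|s t IHs IHt].
  by rewrite !tensorE /= ?tensorE.
by rewrite !tensorD IHs IHt.
Qed.

Lemma cofree_rcoact_counit t : trunit (tmap idfun counit (cofree_rcoact t)) = t.
Proof.
elim/tens_ind: t => [c d|s t IHs IHt]; last first.
  by rewrite cofree_rcoactD !tensorD IHs IHt.
rewrite cofree_rcoactE -[in RHS](comul_counitr d).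
elim/tens_ind: (comul d) => [a b|s t IHs IHt]; first by rewrite !tensorE /= ?tensorE tensZr.
by rewrite !tensorD IHs IHt.
Qed.

Lemma cofree_lrcoactA t : tassoc (tmap cofree_lcoact idfun (cofree_rcoact t)) =
  tmap idfun cofree_rcoact (cofree_lcoact t).
Proof.
elim/tens_ind: t => [c d|s t IHs IHt]; last first.
  by rewrite cofree_lcoactD cofree_rcoactD !tensorD IHs IHt.
rewrite cofree_rcoactE cofree_lcoactE.
transitivity (tassoc (tmap (@tassoc K C C C) idfun (tassocV (comul c \ox comul d)))).
  elim/tens_ind: (comul d) => [a b|s t IHs IHt]; last first.
    by rewrite !tensorD IHs IHt.
  by rewrite !tensorE /= ?tensorE cofree_lcoactE.
elim/tens_ind: (comul c) => [x y|s t IHs IHt]; last first.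
  by rewrite !tensorD IHs IHt.
rewrite !tensorE /= ?tensorE cofree_rcoactE; elim/tens_ind: (comul d) => [a b|s t IHs IHt].
  by rewrite !tensorE /= ?tensorE.
by rewrite !tensorD IHs IHt.
Qed.

(* The standard [C]-bicomodule [C \ox C]. *)
HB.instance Definition _ := Lmodule_isBicomodule.Build K C (C \ox C)%type
  cofree_lcoactA cofree_lcoact_counit cofree_rcoactA cofree_rcoact_counit
  cofree_lrcoactA.

Lemma cofree_lcoact_comul c :
  cofree_lcoact (comul c) = tmap idfun comul (comul c).
Proof. exact: comulA. Qed.

Lemma cofree_rcoact_comul c :
  cofree_rcoact (comul c) = tmap comul idfun (comul c).
Proof. exact: (etrans (congr1 (@tassocV K C C C) (esym (comulA c))) (tassocK _)). Qed.

(* The cokernel of the comultiplication; its bicomodule structure is the one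
   induced by that of [C \ox C]. *)
Definition mho1 : Type := quot (range (@comul K C)).

HB.instance Definition _ := GRing.Lmodule.on mho1.

Definition mho1_proj : C \ox C -> mho1 := qpi (range (@comul K C)).

HB.instance Definition _ := GRing.Linear.on mho1_proj.

Lemma mho1_proj_comul c : mho1_proj (comul c) = 0.
Proof.
rewrite -(linear0 mho1_proj); apply/qpi_eq; rewrite subr0.
by apply: sub_span; exists c.
Qed.

Lemma mho1_proj_lcoact_comul x : range (@comul K C) x ->
  (tmap idfun mho1_proj \o cofree_lcoact) x = 0.
Proof.
case=> c _ <- /=; rewrite cofree_lcoact_comul.
elim/tens_ind: (comul c) => [a b|s t IHs IHt].
  by rewrite !tmapE /= mho1_proj_comul tens0r.
by rewrite !tensorD IHs IHt addr0.
Qed.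

Lemma mho1_proj_rcoact_comul x : range (@comul K C) x ->
  (tmap mho1_proj idfun \o cofree_rcoact) x = 0.
Proof.
case=> c _ <- /=; rewrite cofree_rcoact_comul.
elim/tens_ind: (comul c) => [a b|s t IHs IHt].
  by rewrite !tmapE /= mho1_proj_comul tens0l.
by rewrite !tensorD IHs IHt addr0.
Qed.

Definition mho1_lcoact : mho1 -> C \ox mho1 := qlift mho1_proj_lcoact_comul.
Definition mho1_rcoact : mho1 -> mho1 \ox C := qlift mho1_proj_rcoact_comul.

HB.instance Definition _ := GRing.Linear.on mho1_lcoact.
HB.instance Definition _ := GRing.Linear.on mho1_rcoact.

Lemma mho1_lcoactE t : mho1_lcoact (mho1_proj t) = tmap idfun mho1_proj (lcoact t).
Proof. exact: qlift_pi. Qed.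

Lemma mho1_rcoactE t : mho1_rcoact (mho1_proj t) = tmap mho1_proj idfun (rcoact t).
Proof. exact: qlift_pi. Qed.

Let mho1_surj (y : mho1) : exists t, y = mho1_proj t := qpi_surj y.

HB.instance Definition _ := Lmodule_isBicomodule.Build K C mho1
  (quot_lcoactA mho1_surj mho1_lcoactE)
  (quot_lcoact_counit mho1_surj mho1_lcoactE)
  (quot_rcoactA mho1_surj mho1_rcoactE)
  (quot_rcoact_counit mho1_surj mho1_rcoactE)
  (quot_lrcoactA mho1_surj mho1_lcoactE mho1_rcoactE).

End CofreeBicomodule.

Section FormalSmoothness.
Variables (K : fieldType) (C : coalgType K).

Definition rel_injective (M : bicomodType C) : Prop :=
  forall (X Y : bicomodType C) (i : {linear X -> Y}) (f : {linear X -> M}),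
    bicomod_morphism i -> (exists r : {linear Y -> X}, cancel i r) ->
    bicomod_morphism f ->
    exists g : {linear Y -> M}, bicomod_morphism g /\ g \o i =1 f.

Definition formally_smooth : Prop := rel_injective (mho1 C).

End FormalSmoothness.

Section WeakProjection.
Variables (K : fieldType) (E : bialgType K) (P : pred E) (H : subHopfAlgType P).

Definition weak_projection (p : {linear E -> H}) : Prop :=
  [/\ forall h : H, p (val h) = h,
      forall (h : H) (x : E), p (val h * x) = h * p x &
      coalg_morphism p].

End WeakProjection.

(* Main.v *)
(* Every subspace is the kernel of an idempotent, so the proof works with total
   linear maps on [E] and Sweedler sums. By Zorn's lemma there is a maximal weak
   projection [q] defined on a left [H]-stable subcoalgebra [C] containing [H];
   it extends to the wedge [C /\ C], which by maximality equals [C]. If [C] were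
   proper, the comodule [E / C] would contain a simple subcomodule, whose
   coefficients form a simple subcoalgebra; as it lies in the coradical, hence
   in [C], the wedge would be larger than [C].

   The extension has two steps. Formal smoothness gives a bicomodule retraction
   [sigma : H \ox mho -> mho] of the left coaction of [mho := mho1 H]. With
   [F x := pr (q x_1 \ox q x_2)] and
   [tau (pr (h \ox k)) := eps(h) k - eps(k) h], the map
   [x |-> q x - tau (sigma (q x_1 \ox F x_2))] is a coalgebra map on [C /\ C].
   It need not be [H]-linear there; but [(C /\ C) / C] is a left Hopf module over
   [H], hence generated by its coinvariants, and replacing [q] by
   [x |-> q x - d (q x_1) (P x_2)], with [d h x := q (h x) - h (q x)] and
   [P x := S (q x_1) x_2], keeps the values on lifts of coinvariants and restores
   linearity. *)

From HB Require Import structures.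
Require Import Defs.
From mathcomp Require Import all_boot all_order all_algebra.
From mathcomp Require Import boolp classical_sets.

Set Implicit Arguments.
Unset Strict Implicit.
Unset Printing Implicit Defensive.

Import GRing.Theory.

Local Open Scope classical_set_scope.
Local Open Scope ring_scope.

(** * Extension of linear maps *)

Section LinearFunction.
Variables (K : fieldType) (U V : lmodType K).

Lemma lin_of_linear (f : U -> V) : linear f -> exists g : {linear U -> V}, g =1 f.
Proof.
move=> fL; pose L := GRing.isLinear.Build K U V *:%R f fL.
by exists (HB.pack_for {linear U -> V} f L).
Qed.

Definition lin (f : U -> V) (fL : linear f) : {linear U -> V} :=
  projT1 (cid (lin_of_linear fL)).

Lemma linE f (fL : linear f) x : lin fL x = f x.
Proof. by rewrite /lin; case: cid => g /= ->. Qed.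

End LinearFunction.

Section Extension.
Variables (K : fieldType) (V W : lmodType K).
Implicit Type G : set (V * W).

(** For a submodule of [V * W] the condition at [0] suffices: such a [G] is the graph of a linear
    map on its first projection. *)
Definition single_valued G := forall y, G (0, y) -> y = 0.

Lemma single_valuedP G : is_submod G -> single_valued G ->
  forall x y y', G (x, y) -> G (x, y') -> y = y'.
Proof.
move=> /is_submodP[_ GZ] Gs x y y' Gy Gy'; apply/eqP; rewrite -subr_eq0.
apply/eqP/Gs; have := GZ (-1) _ _ Gy' Gy.
by rewrite /GRing.scale /= /GRing.add /= /add_pair /= !scaleN1r addNr addrC.
Qed.

(** Zorn's lemma on graphs with values in [D]: a maximal one is defined everywhere, since a missing
    point can always be sent to [0]. *)
Lemma total_extension_in G0 (D : set W) :
  is_submod D -> is_submod G0 -> single_valued G0 -> G0 `<=` [set u | D u.2] ->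
  exists2 f : {linear V -> W}, forall x y, G0 (x, y) -> f x = y & forall x, D (f x).
Proof.
move=> /is_submodP[D0 DZ] G0M G0s G0D.
(* The union with [G0] is there for the empty chain, whose union is the empty set. *)
pose P G := [/\ is_submod (G `|` G0), single_valued (G `|` G0) &
                G `|` G0 `<=` [set u | D u.2]].
have [F FP Ftot|G [[GM Gs GD] Gmax]] := @Zorn_bigcup _ P.
  have E u : (\bigcup_(X in F) X `|` G0) u -> 
      G0 u \/ exists2 X, F X & (X `|` G0) u.
    by case=> [[X FX Xu]|]; [right; exists X => //; left|left].
  have I X u : F X -> (X `|` G0) u -> (\bigcup_(X in F) X `|` G0) u.
    by move=> FX [Xu|]; [left; exists X|right].
  have sub0 X : X `<=` X `|` G0 by move=> ? ?; left.
  split; last by move=> u /E[/G0D//|[X FX Xu]]; have [_ _] := FP _ FX; apply.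
    apply/is_submodP; split; first by right; case/is_submodP: G0M.
    move=> a x y /E[x0|[X FX Xx]] /E[y0|[Y FY Yy]].
    - by right; case/is_submodP: G0M => _; apply.
    - have [/is_submodP[_ h] _ _] := FP _ FY; apply: (I _ _ FY); apply: h => //.
      by right.
    - have [/is_submodP[_ h] _ _] := FP _ FX; apply: (I _ _ FX); apply: h => //.
      by right.
    - have [/is_submodP[_ hX] _ _] := FP _ FX; have [/is_submodP[_ hY] _ _] := FP _ FY.
      have [XY|YX] := Ftot _ _ FX FY.
        apply: (I _ _ FY); apply: hY => //.
        by case: Xx => [/XY|]; [left|right].
      apply: (I _ _ FX); apply: hX => //.
      by case: Yy => [/YX|]; [left|right].
  by move=> y /E[/G0s//|[X FX Xy]]; have [_ + _] := FP _ FX; exact.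
have /is_submodP[GG0 GZ] := GM.
have Gdom x : exists y, (G `|` G0) (x, y).
  apply: contrapT => nx.
  pose G' : set (V * W) := [set u | exists a v, (G `|` G0) v /\ u = (a *: x + v.1, v.2)].
  have sub : G `|` G0 `<=` G'.
    by case=> v w Gv; exists 0, (v, w); split=> //=; rewrite scale0r add0r.
  have GG' : G' `|` G0 = G'.
    by apply/seteqP; split=> [u []// ?|u]; [apply: sub; right|left].
  have G'x : G' (x, 0).
    by exists 1, 0; split=> //=; rewrite scale1r addr0.
  apply: (Gmax G').
    split=> [u Gu|h]; first by apply: sub; left.
    by apply: nx; exists 0; left; apply: h.
  rewrite /P GG'; split.
  - apply/is_submodP; split; first by apply: sub.
    move=> a _ _ [b [v [Gv ->]]] [c [w [Gw ->]]].
    exists (a * b + c), (a *: v + w); split; first exact: GZ.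
    congr pair; rewrite /= scalerDr scalerDl scalerA -!addrA; congr (_ + _).
    by rewrite addrCA.
  (* If [a] is nonzero, then [x] is a multiple of [v] and was already in the domain. *)
  - move=> y [a [[v w] [Gv [/esym e ->]]]] /=.
    have [a0|a0] := eqVneq a 0.
      by move: e; rewrite a0 scale0r add0r => /= v0; apply: Gs; rewrite -v0.
    case: nx; exists (- a^-1 *: w).
    have -> : x = - a^-1 *: v.
      have -> : v = - (a *: x) by apply/eqP; rewrite -addr_eq0 addrC; apply/eqP.
      by rewrite scaleNr scalerN opprK scalerA mulVf ?scale1r.
    have := GZ (- a^-1) _ _ Gv GG0; rewrite addr0; exact.
  - by move=> _ [a [v [/GD Dv ->]]].
pose f x := projT1 (cid (Gdom x)).
have fG x : (G `|` G0) (x, f x) by rewrite /f; case: cid.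
have fL : linear f.
  move=> a x y; apply: (single_valuedP GM Gs (fG _)).
  exact: GZ a _ _ (fG x) (fG y).
exists (lin fL) => [x y Gx|x]; rewrite linE; last exact: GD (fG x).
by apply: (single_valuedP GM Gs (fG _)); right.
Qed.

Lemma total_extension G0 : is_submod G0 -> single_valued G0 ->
  exists f : {linear V -> W}, forall x y, G0 (x, y) -> f x = y.
Proof.
move=> G0M G0s; have TM : is_submod (@setT W) by apply/is_submodP.
by have [//|f fP _] := total_extension_in TM G0M G0s; exists f.
Qed.

End Extension.

(** The identity of [D] extends to a linear [f] with values in [D], that is, a projection onto [D];
    take [e] to be [id - f]. *)
Lemma idempotent_ker (K : fieldType) (V : lmodType K) (D : set V) :
  is_submod D -> exists2 e : {linear V -> V},
    (forall x, D x <-> e x = 0) & (forall x, e (e x) = e x).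
Proof.
move=> DM; have /is_submodP[D0 DZ] := DM.
pose G : set (V * V) := [set u | D u.1 /\ u.2 = u.1].
have [|y []//|u [Du e]|f fG fD] := @total_extension_in _ _ _ G D DM.
  apply/is_submodP; split; first by [].
  move=> a [x x'] [y y'] /= [Dx ex] [Dy ey]; move: ex ey => /= -> ->.
  by split=> //; apply: DZ.
  by rewrite /= e.
have fid x : D x -> f x = x by move=> Dx; apply: fG.
have eL : linear (fun x => x - f x).
  by move=> a x y; rewrite linearP scalerBr opprD addrACA.
exists (lin eL) => x; rewrite !linE.
  by split=> [/fid ->|/eqP]; rewrite ?subrr// subr_eq0 => /eqP->.
by rewrite linearB /= (fid (f x))// subrr subr0.
Qed.

(** * Sweedler sums *)

Section TensorSum.
Variables (K : fieldType) (U V : lmodType K).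

Lemma tens_sumP (t : U \ox V) : exists s : seq (U * V), t = \sum_(p <- s) p.1 \ox p.2.
Proof.
elim/tens_ind: t => [u v|s t [rs ->] [rt ->]].
  by exists [:: (u, v)]; rewrite big_seq1.
by exists (rs ++ rt); rewrite big_cat.
Qed.

Definition trep (t : U \ox V) : seq (U * V) := projT1 (cid (tens_sumP t)).

Lemma trepE t : t = \sum_(p <- trep t) p.1 \ox p.2.
Proof. by rewrite /trep; case: cid. Qed.

(* Sweedler sums: the value is independent of the chosen representation
   whenever [G] is bilinear, see [tsum_lift]. *)
Definition tsum (W : lmodType K) (G : U -> V -> W) (t : U \ox V) : W :=
  \sum_(p <- trep t) G p.1 p.2.

Lemma tsum_tens t : tsum (@tens K U V) t = t.
Proof. by rewrite [RHS]trepE. Qed.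

Variable W : lmodType K.
Implicit Type G : U -> V -> W.

Lemma linear_tsum (W' : lmodType K) (f : {linear W -> W'}) G t :
  f (tsum G t) = tsum (fun u v => f (G u v)) t.
Proof. exact: linear_sum. Qed.

Lemma tsumE (f : {linear (U \ox V)%type -> W}) t : f t = tsum (fun u v => f (u \ox v)) t.
Proof. by rewrite -[in LHS](tsum_tens t) linear_sum. Qed.

Lemma tsum_lift G (bG : bilinear_for *:%R *:%R G) t : tsum G t = tlift bG t.
Proof. by rewrite tsumE; apply: eq_bigr => p _; rewrite /= tliftE. Qed.

Lemma tsum_linear G : bilinear_for *:%R *:%R G -> linear (tsum G).
Proof. by move=> bG a s t; rewrite !tsum_lift linearP. Qed.

Lemma tsum_tensE G u v : bilinear_for *:%R *:%R G -> tsum G (u \ox v) = G u v.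
Proof. by move=> bG; rewrite tsum_lift tliftE. Qed.

Lemma tsum_arg0 G : bilinear_for *:%R *:%R G -> tsum G 0 = 0.
Proof. by move=> bG; rewrite tsum_lift linear0. Qed.

Lemma eq_tsum G G' t : (forall u v, G u v = G' u v) -> tsum G t = tsum G' t.
Proof. by move=> e; apply: eq_bigr. Qed.

Lemma tsumD G G' t : tsum (fun u v => G u v + G' u v) t = tsum G t + tsum G' t.
Proof. exact: big_split. Qed.

Lemma tsumN G t : tsum (fun u v => - G u v) t = - tsum G t.
Proof. exact: sumrN. Qed.

Lemma tsumB G G' t : tsum (fun u v => G u v - G' u v) t = tsum G t - tsum G' t.
Proof. by rewrite -tsumN -tsumD. Qed.

Lemma tsumZ a G t : tsum (fun u v => a *: G u v) t = a *: tsum G t.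
Proof. by rewrite /tsum scaler_sumr. Qed.

End TensorSum.

Lemma tsum_exchange (K : fieldType) (U V U' V' W : lmodType K)
    (G : U -> V -> U' -> V' -> W) s t :
  tsum (fun u v => tsum (G u v) t) s =
  tsum (fun u' v' => tsum (fun u v => G u v u' v') s) t.
Proof. exact: exchange_big. Qed.

Section NestedSums.
Variables (K : fieldType) (U V U' V' W : lmodType K).

Lemma tsum_tsum (G : U' -> V' -> W) (F : U -> V -> (U' \ox V')%type) t :
  bilinear_for *:%R *:%R G -> tsum G (tsum F t) = tsum (fun u v => tsum G (F u v)) t.
Proof.
move=> bG; rewrite tsum_lift linear_tsum.
by apply: eq_tsum => u v; rewrite tsum_lift.
Qed.

Lemma tsum_tensl (G : U -> V -> U') t (w : V') :
  tsum G t \ox w = tsum (fun u v => G u v \ox w) t.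
Proof. exact: (big_morph (fun x => x \ox w) (fun x y => tensDl x y w) (tens0l _ w)). Qed.

Lemma tsum_tensr (G : U -> V -> V') t (w : U') :
  w \ox tsum G t = tsum (fun u v => w \ox G u v) t.
Proof. exact: (big_morph (fun x => w \ox x) (fun x y => tensDr w x y) (tens0r _ w)). Qed.

End NestedSums.

(** * Closure properties of linearity and their automation *)

Section Linearity.
Variables (K : fieldType) (X U V W : lmodType K).

Lemma linear_id : linear (fun x : X => x). Proof. by []. Qed.

Lemma linear_comp (h : U -> V) (g : X -> U) :
  linear h -> linear g -> linear (fun x => h (g x)).
Proof. by move=> hL gL a x y; rewrite gL hL. Qed.

Lemma linear_zero : linear (fun _ : X => 0 : U).
Proof. by move=> a x y; rewrite scaler0 addr0. Qed.

Lemma linear_app (f : {linear U -> V}) (g : X -> U) :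
  linear g -> linear (fun x => f (g x)).
Proof. by move=> gL a x y; rewrite gL linearP. Qed.

Lemma linear_add (f g : X -> U) : linear f -> linear g -> linear (fun x => f x + g x).
Proof. by move=> fL gL a x y; rewrite fL gL scalerDr addrACA. Qed.

Lemma linear_opp (f : X -> U) : linear f -> linear (fun x => - f x).
Proof. by move=> fL a x y; rewrite fL opprD scalerN. Qed.

Lemma linear_scaler a (f : X -> U) : linear f -> linear (fun x => a *: f x).
Proof. by move=> fL b x y; rewrite fL scalerDr !scalerA mulrC. Qed.

Lemma linear_scalel (u : U) (f : X -> K^o) : linear f -> linear (fun x => (f x : K) *: u).
Proof. by move=> fL b x y; rewrite fL scalerDl scalerA. Qed.

Lemma linear_tensl (v : V) (f : X -> U) : linear f -> linear (fun x => f x \ox v).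
Proof. by move=> fL b x y; rewrite fL tensPl. Qed.

Lemma linear_tensr (u : U) (f : X -> V) : linear f -> linear (fun x => u \ox f x).
Proof. by move=> fL b x y; rewrite fL tensPr. Qed.

Lemma linear_tsum_fun (G : X -> U -> V -> W) t :
  (forall u v, linear (fun x => G x u v)) -> linear (fun x => tsum (G x) t).
Proof.
by move=> GL a x y; rewrite -tsumZ -tsumD; apply: eq_tsum => u v; rewrite GL.
Qed.

Lemma linear_tsum_arg (G : U -> V -> W) (f : X -> (U \ox V)%type) :
  (forall v, linear (fun u => G u v)) -> (forall u, linear (fun v => G u v)) ->
  linear f -> linear (fun x => tsum G (f x)).
Proof. by move=> Gl Gr fL a x y; rewrite fL tsum_linear. Qed.

End Linearity.

Section AlgebraLinearity.
Variables (K : fieldType) (X : lmodType K) (A : algType K).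

Lemma linear_mull (b : A) (f : X -> A) : linear f -> linear (fun x => f x * b).
Proof. by move=> fL a x y; rewrite fL mulrDl scalerAl. Qed.

Lemma linear_mulr (b : A) (f : X -> A) : linear f -> linear (fun x => b * f x).
Proof. by move=> fL a x y; rewrite fL mulrDr scalerAr. Qed.

End AlgebraLinearity.

(** Failing on the identity prevents a loop: composing with it would leave the goal unchanged. *)
Ltac lin_comp h f :=
  lazymatch f with
  | (fun x => x) => fail
  | _ => apply: (@linear_comp _ _ _ _ h f)
  end.
Ltac is_lam h := lazymatch h with (fun x => _) => idtac end.
Ltac lin1 :=
  match goal with
  | |- bilinear_for _ _ _ => split
  | |- forall _, _ => intro
  | |- GRing.linear_for _ (fun x => x) => exact: linear_id
  | |- GRing.linear_for _ (fun x => 0) => exact: linear_zero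
  | |- GRing.linear_for _ (fun x => _ + _) => apply: linear_add
  | |- GRing.linear_for _ (fun x => - _) => apply: linear_opp
  | |- GRing.linear_for _ (fun x => tens (@?f x) ?v) => apply: (@linear_tensl _ _ _ _ v f)
  | |- GRing.linear_for _ (fun x => tens ?u (@?f x)) => apply: (@linear_tensr _ _ _ _ u f)
  | |- GRing.linear_for _ (fun x => tsum (@?G x) ?t) => apply: linear_tsum_fun
  | |- GRing.linear_for _ (fun x => tsum ?G (@?f x)) => apply: linear_tsum_arg
  | |- GRing.linear_for _ (fun x => GRing.scale ?a (@?f x)) => apply: linear_scaler
  | |- GRing.linear_for _ (fun x => GRing.scale (@?f x) ?u) => apply: (@linear_scalel _ _ _ u f)
  | |- GRing.linear_for _ (fun x => GRing.mul ?a (@?f x)) => apply: (@linear_mulr _ _ _ a f)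
  | |- GRing.linear_for _ (fun x => GRing.mul (@?f x) ?a) => apply: (@linear_mull _ _ _ a f)
  | |- GRing.linear_for _ (fun x => GRing.Linear.sort ?h (@?f x)) =>
      apply: (@linear_app _ _ _ _ h f)
  | |- GRing.linear_for _ (tens ?u) => exact: (linear_tensr u (@linear_id _ _))
  | |- GRing.linear_for _ (GRing.mul ?a) => exact: (linear_mulr a (@linear_id _ _))
  | |- GRing.linear_for _ (tsum _) => apply: tsum_linear
  | |- GRing.linear_for _ ?h => tryif is_lam h then fail else solve [exact: linearP]
  | H : context [GRing.linear_for] |- GRing.linear_for _ _ => solve [apply H]
  | |- GRing.linear_for ?s (fun x => ?h x) => change (GRing.linear_for s h)
  | |- GRing.linear_for _ (fun x => ?F (@?f x)) => lin_comp F f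
  | |- GRing.linear_for _ (fun x => ?F (@?f x) ?b) => lin_comp (fun y => F y b) f
  | |- GRing.linear_for _ (fun x => ?F (@?f x) ?b ?c) => lin_comp (fun y => F y b c) f
  end.
Ltac lin := repeat lin1.
(** * Separation by linear functionals *)

Section Separation.
Variable K : fieldType.

Lemma functional_sep (V : lmodType K) (D : set V) v : is_submod D -> ~ D v ->
  exists2 f : {linear V -> K^o}, f v = 1 & forall x, D x -> f x = 0.
Proof.
move=> /is_submodP[D0 DZ] Dv.
have DN a x : D x -> D (a *: x) by move=> Dx; rewrite -[_ *: _]addr0; apply: DZ.
(* The graph of the functional on [D + K v] that kills [D] and takes the value [1] at [v]. *)
pose G : set (V * K^o) := [set u | D (u.1 - (u.2 : K) *: v)].
have [||f fG] := @total_extension _ _ _ G.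
- apply/is_submodP; split; first by rewrite /G /= scale0r subr0.
  move=> a [x b] [y c] /= Dx Dy.
  suff e : a *: x + y - (a * b + c) *: v = a *: (x - b *: v) + (y - c *: v).
    by change (D (a *: x + y - (a * b + c) *: v)); rewrite e; apply: DZ.
  by rewrite scalerDl opprD scalerBr scalerA !addrA; congr (_ - _); rewrite addrAC.
- move=> c /=; rewrite /G /= sub0r => Dc; apply: contrapT => /eqP c0; apply: Dv.
  have -> : v = - c^-1 *: (- (c *: v)).
    by rewrite scalerN scaleNr opprK scalerA mulVf ?scale1r.
  exact: DN.
- exists f => [|x Dx]; apply: fG; rewrite /G /=; first by rewrite scale1r subrr.
  by rewrite scale0r subr0.
Qed.

Lemma functional_separated (V : lmodType K) (v : V) :
  (forall f : {linear V -> K^o}, f v = 0) -> v = 0.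
Proof.
move=> fv; apply: contrapT => v0.
have [||f f1 _] := @functional_sep V [set 0] v.
- by apply/is_submodP; split=> // a x y -> ->; rewrite scaler0 addr0.
- by move=> /= ?.
- by have := fv f; rewrite f1 => /eqP; rewrite oner_eq0.
Qed.

Definition lincomb (V : lmodType K) n (v : 'I_n -> V) : set V :=
  [set x | exists a : 'I_n -> K, x = \sum_i a i *: v i].

Lemma lincomb_submod (V : lmodType K) n (v : 'I_n -> V) : is_submod (lincomb v).
Proof.
apply/is_submodP; split.
  by exists (fun=> 0); rewrite big1 // => i _; rewrite scale0r.
move=> a _ _ [b ->] [c ->]; exists (fun i => a * b i + c i).
rewrite scaler_sumr -big_split; apply: eq_bigr => i _.
by rewrite scalerDl scalerA.
Qed.

Lemma tens_sum_ordP (U V : lmodType K) (t : U \ox V) :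
  exists n (u : 'I_n -> U) (v : 'I_n -> V), t = \sum_i u i \ox v i.
Proof.
have [s ->] := tens_sumP t.
exists (size s), (fun i => (tnth (in_tuple s) i).1), (fun i => (tnth (in_tuple s) i).2).
by rewrite big_tnth.
Qed.

Lemma tens_sumr (U V : lmodType K) n (u : U) (v : 'I_n -> V) :
  u \ox (\sum_i v i) = \sum_i u \ox v i.
Proof. exact: (big_morph (fun x : V => u \ox x) (fun x y => tensDr u x y) (tens0r _ u)). Qed.

Lemma tensNl (U V : lmodType K) (u : U) (v : V) : (- u) \ox v = - (u \ox v).
Proof. by rewrite -scaleN1r tensZl scaleN1r. Qed.

Lemma tensNr (U V : lmodType K) (u : U) (v : V) : u \ox (- v) = - (u \ox v).
Proof. by rewrite -scaleN1r tensZr scaleN1r. Qed.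

Lemma tensBl (U V : lmodType K) (u u' : U) (v : V) : (u - u') \ox v = u \ox v - u' \ox v.
Proof. by rewrite tensDl tensNl. Qed.

Lemma tensBr (U V : lmodType K) (u : U) (v v' : V) : u \ox (v - v') = u \ox v - u \ox v'.
Proof. by rewrite tensDr tensNr. Qed.

(** Induction on the number of summands. If [v ord0] is a combination of the other right factors,
    its summand is absorbed by theirs; otherwise a functional that is [1] on it and [0] on the
    others gives [u ord0 = 0]. *)
Lemma tens_separated_r (U V : lmodType K) (t : U \ox V) :
  (forall f : {linear V -> K^o}, tsum (fun u v => (f v : K) *: u) t = 0) -> t = 0.
Proof.
have [n] := tens_sum_ordP t; elim: n t => [|n IHn] t [u [v tE]] ft.
  by rewrite tE big_ord0.
pose w i := v (lift ord0 i).
have [[a vE]|vN] := pselect (lincomb w (v ord0)).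
  apply: IHn ft; exists (fun i => u (lift ord0 i) + a i *: u ord0), w.
  rewrite tE big_ord_recl vE tens_sumr -big_split.
  by apply: eq_bigr => i _; rewrite tensDl tensZl tensZr addrC.
have [f f1 f0] := functional_sep (lincomb_submod w) vN.
apply: (IHn _ _ ft); exists (fun i => u (lift ord0 i)), w.
suff u0 : u ord0 = 0 by rewrite tE big_ord_recl u0 tens0l add0r.
rewrite -(ft f) tE.
have FL : linear (tsum (fun (x : U) y => (f y : K) *: x)) by apply: tsum_linear; lin.
rewrite -(linE FL) linear_sum big_ord_recl big1 => [|i _] /=.
  by rewrite linE tsum_tensE ?f1 ?scale1r ?addr0//; lin.
rewrite linE tsum_tensE ?f0 ?scale0r//; last by lin.
exists (fun j => (j == i)%:R); rewrite (bigD1 i)//= eqxx scale1r big1 ?addr0// => j.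
by move=> /negPf ->; rewrite scale0r.
Qed.

Lemma tens_separated_l (U V : lmodType K) (t : U \ox V) :
  (forall f : {linear U -> K^o}, tsum (fun u v => (f u : K) *: v) t = 0) -> t = 0.
Proof.
(* The flip of the two factors reduces the claim to [tens_separated_r]. *)
pose S (U V : lmodType K) (t : U \ox V) : V \ox U := tsum (fun u v => v \ox u) t.
have SL (U' V' : lmodType K) : linear (@S U' V') by rewrite /S; lin.
move=> ft; have S0 : S _ _ t = 0.
  apply: tens_separated_r => f; rewrite -(ft f).
  have L : linear (tsum (fun (v : V) (u : U) => (f u : K) *: v)) by apply: tsum_linear; lin.
  rewrite -(linE L) linear_tsum; apply: eq_tsum => u v.
  by rewrite linE tsum_tensE//; lin.
rewrite -(tsum_tens t) -[RHS](linear0 (lin (SL _ _))) -S0 linear_tsum.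
by apply: eq_tsum => u v; rewrite linE /S tsum_tensE//; lin.
Qed.

(** A drop of dimension. Take [f] linear with [f = id] on [D] and [f m = 0]: applied to the
    expression of [m], it makes some [f (v j)] a combination of the other [f (v i)], and these [n]
    vectors then span a space containing [f D = D]. *)
Lemma lincomb_proper (V : lmodType K) n (v : 'I_n.+1 -> V) (D : set V) m :
  is_submod D -> D `<=` lincomb v -> lincomb v m -> ~ D m ->
  exists w : 'I_n -> V, D `<=` lincomb w.
Proof.
move=> DM Dv [a mE] Dm; have /is_submodP[D0 DZ] := DM.
have [j aj] : exists j, a j != 0.
  apply: contrapT => nj; apply: Dm; rewrite mE big1// => i _.
  suff -> : a i = 0 by rewrite scale0r.
  by apply: contrapT => /eqP ai; apply: nj; exists i.
pose G : set (V * V) := [set u | D u.2 /\ exists c : K, u.1 = u.2 + c *: m].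
have [||f fG] := @total_extension _ _ _ G.
- apply/is_submodP; split; first by split=> //; exists 0; rewrite scale0r addr0.
  move=> b [x x'] [y y'] /= [Dx [c /= ->]] [Dy [d /= ->]]; split; first exact: DZ.
  exists (b * c + d) => /=; rewrite scalerDr scalerDl scalerA -!addrA; congr (_ + _).
  by rewrite addrCA.
- move=> y [/= Dy [c /esym/eqP]]; rewrite addr_eq0 => /eqP ym.
  have [c0|c0] := eqVneq c 0; first by rewrite ym c0 scale0r oppr0.
  case: Dm; have -> : m = - c^-1 *: y + 0.
    by rewrite ym addr0 scalerN scaleNr opprK scalerA mulVf ?scale1r.
  exact: DZ.
have fm : f m = 0.
  by apply: fG; split=> //=; exists 1; rewrite scale1r add0r.
have fD x : D x -> f x = x.
  by move=> Dx; apply: fG; split=> //=; exists 0; rewrite scale0r addr0.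
have fvj : f (v j) = \sum_i (- ((a j)^-1 * a (lift j i))) *: f (v (lift j i)).
  have : \sum_i a i *: f (v i) = 0.
    by rewrite -[RHS]fm mE linear_sum; apply: eq_bigr => i _; rewrite linearZ.
  rewrite (bigD1_ord j)//= => /eqP; rewrite addr_eq0 => /eqP e.
  rewrite -[LHS]scale1r -(mulVf aj) -scalerA e scalerN scaler_sumr -sumrN.
  by apply: eq_bigr => i _; rewrite scalerA scaleNr.
exists (fun i => f (v (lift j i))) => x Dx; have [b xE] := Dv _ Dx.
exists (fun i => b (lift j i) - b j * ((a j)^-1 * a (lift j i))).
rewrite -(fD _ Dx) xE linear_sum (bigD1_ord j)//= linearZ /= fvj.
rewrite scaler_sumr -big_split; apply: eq_bigr => i _ /=.
by rewrite (linearZ_LR f) scalerBl addrC scalerA mulrN scaleNr.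
Qed.

End Separation.

Lemma tens_ext (K : fieldType) (U V W : lmodType K) (F G : (U \ox V)%type -> W) :
  linear F -> linear G -> (forall u v, F (u \ox v) = G (u \ox v)) -> F =1 G.
Proof.
move=> FL GL FG t; rewrite -(tsum_tens t) -(linE FL) -(linE GL) !linear_tsum.
by apply: eq_tsum => u v; rewrite !linE.
Qed.

Lemma tsum_tmap (K : fieldType) (U U' V V' W : lmodType K)
    (f : {linear U -> U'}) (g : {linear V -> V'}) (G : U' -> V' -> W) t :
  (forall v, linear (G^~ v)) -> (forall u, linear (G u)) ->
  tsum G (tmap f g t) = tsum (fun u v => G (f u) (g v)) t.
Proof.
move=> Gl Gr; move: t; apply: tens_ext => [||u v]; [by lin..|].
by rewrite tmapE !tsum_tensE//; lin.
Qed.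

Lemma tmap_tsum (K : fieldType) (U U' V V' : lmodType K)
    (f : {linear U -> U'}) (g : {linear V -> V'}) t :
  tmap f g t = tsum (fun u v => f u \ox g v) t.
Proof. by rewrite -[LHS]tsum_tens tsum_tmap//; lin. Qed.

Section CoalgebraSums.
Variables (K : fieldType) (C : coalgType K).

Lemma tsum_coassoc (W : lmodType K) (F : C -> C -> C -> W) x :
  (forall b c, linear (fun a => F a b c)) -> (forall a c, linear (fun b => F a b c)) ->
  (forall a b, linear (fun c => F a b c)) ->
  tsum (fun a b => tsum (fun c d => F c d b) (comul a)) (comul x) =
  tsum (fun a b => tsum (fun c d => F a c d) (comul b)) (comul x).
Proof.
move=> F1 F2 F3.
have L : linear (tsum (fun a t => tsum (F a) t)) by apply: tsum_linear; lin.
transitivity (lin L (tassoc (tmap comul idfun (comul x)))); last first.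
  by rewrite comulA linE tsum_tmap//; lin.
move: (comul x); apply: tens_ext => [||a b]; [by lin..|].
rewrite tmapE tsum_tensE /=; last by lin.
move: (comul a); apply: tens_ext => [||c d]; [by lin..|].
rewrite tassocE linE !tsum_tensE//; lin.
Qed.

Lemma tsum_counitl (W : lmodType K) (f : C -> W) x : linear f ->
  tsum (fun a b => (counit a : K) *: f b) (comul x) = f x.
Proof.
move=> fL; rewrite -[in RHS](comul_counitl x).
move: (comul x); apply: tens_ext => [||a b]; [by lin..|].
rewrite !tensorE tsum_tensE; last by lin.
by rewrite -!(linE fL) linearZ_LR.
Qed.

Lemma tsum_counitr (W : lmodType K) (f : C -> W) x : linear f ->
  tsum (fun a b => (counit b : K) *: f a) (comul x) = f x.
Proof.
move=> fL; rewrite -[in RHS](comul_counitr x).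
move: (comul x); apply: tens_ext => [||a b]; [by lin..|].
rewrite !tensorE tsum_tensE; last by lin.
by rewrite -!(linE fL) linearZ_LR.
Qed.

End CoalgebraSums.
(** * The coradical and wedges *)

Section Translates.
Variables (K : fieldType) (C : coalgType K).
Implicit Types (f g h : {linear C -> K^o}) (x : C) (D : set C).

(* The actions of the dual algebra: [ltr g x = g(x_1) x_2] and
   [rtr g x = x_1 g(x_2)]. *)
Definition ltr g x : C := tsum (fun a b => (g a : K) *: b) (comul x).
Definition rtr g x : C := tsum (fun a b => (g b : K) *: a) (comul x).

Lemma ltr_linear g : linear (ltr g). Proof. by rewrite /ltr; lin. Qed.
Lemma rtr_linear g : linear (rtr g). Proof. by rewrite /rtr; lin. Qed.

HB.instance Definition _ g := GRing.isLinear.Build K C C *:%R (ltr g) (ltr_linear g).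
HB.instance Definition _ g := GRing.isLinear.Build K C C *:%R (rtr g) (rtr_linear g).

Lemma ltr_counit x : ltr counit x = x. Proof. exact: tsum_counitl. Qed.

Lemma ltr_rtr g f x : ltr g (rtr f x) = rtr f (ltr g x).
Proof.
transitivity (tsum (fun a b : C =>
  tsum (fun c d : C => (f b : K) *: ((g c : K) *: d)) (comul a)) (comul x)).
  rewrite {1}/rtr linear_tsum; apply: eq_tsum => a b.
  by rewrite linearZ_LR -tsumZ.
rewrite (tsum_coassoc (F := fun c d b : C => (f b : K) *: ((g c : K) *: d))); [|by lin..].
rewrite [ltr g x]/ltr linear_tsum; apply: eq_tsum => a b.
by rewrite linearZ_LR -tsumZ; apply: eq_tsum => c d; rewrite !scalerA mulrC.
Qed.

Lemma pairing_tr f g x : g (rtr f x) = f (ltr g x).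
Proof.
rewrite /rtr /ltr !linear_tsum; apply: eq_tsum => a b.
by rewrite !linearZ_LR; apply: mulrC.
Qed.

Lemma tsum_scalel (U V W : lmodType K) (G : U -> V -> K^o) t (w : W) :
  (tsum G t : K) *: w = tsum (fun u v => (G u v : K) *: w) t.
Proof. exact: scaler_suml. Qed.

(** Iterated translates are single translates, so the elements [ltr g x] already form the left
    comodule generated by [x]; [g \o ltr h] is the convolution product of [h] and [g]. *)
Lemma ltr_ltr g h x : ltr g (ltr h x) = ltr (g \o ltr h) x.
Proof.
transitivity (tsum (fun a b : C =>
  tsum (fun c d : C => (h c : K) *: ((g d : K) *: b)) (comul a)) (comul x)).
  rewrite (tsum_coassoc (F := fun c d b : C => (h c : K) *: ((g d : K) *: b))); [|by lin..].
  rewrite [ltr h x]/ltr linear_tsum; apply: eq_tsum => a b.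
  by rewrite linearZ_LR -tsumZ.
apply: eq_tsum => a b /=; rewrite /ltr linear_tsum tsum_scalel.
by apply: eq_tsum => c d; rewrite (linearZ_LR g) scalerA.
Qed.

Lemma rtr_rtr g h x : rtr g (rtr h x) = rtr (g \o rtr h) x.
Proof.
transitivity (tsum (fun a b : C =>
  tsum (fun c d : C => (h b : K) *: ((g d : K) *: c)) (comul a)) (comul x)).
  rewrite [rtr h x]/rtr linear_tsum; apply: eq_tsum => a b.
  by rewrite linearZ_LR -tsumZ.
rewrite (tsum_coassoc (F := fun c d b : C => (h b : K) *: ((g d : K) *: c))); [|by lin..].
apply: eq_tsum => a b /=; rewrite /rtr linear_tsum tsum_scalel.
by apply: eq_tsum => c d; rewrite (linearZ_LR g) scalerA.
Qed.

Lemma dual_lincomb a f g : exists h : {linear C -> K^o}, forall x, h x = a *: f x + g x.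
Proof.
have L : linear (fun x => a *: f x + g x) by lin.
by exists (lin L) => x; rewrite linE.
Qed.

Lemma ltr_lincomb a f g : exists h, forall x, ltr h x = a *: ltr f x + ltr g x.
Proof.
have [h hE] := dual_lincomb a f g; exists h => x; rewrite /ltr -tsumZ -tsumD.
by apply: eq_tsum => u v; rewrite hE scalerDl scalerA.
Qed.

Definition tr_stable D :=
  [/\ is_submod D, forall g x, D x -> D (ltr g x) & forall g x, D x -> D (rtr g x)].

(** For the converse, let [D] be the kernel of the idempotent [e]. Stability and separation by
    functionals show that [e] kills either factor of [comul x], so [id - e], with values in [D], may
    be applied to both. *)
Lemma subcoalgebraP D : subcoalgebra D <-> tr_stable D.
Proof.
split=> [[DM DC]|[DM Dl Dr]].
  have /is_submodP[D0 DZ] := DM.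
  have DZ' a x : D x -> D (a *: x) by move=> Dx; rewrite -[_ *: _]addr0; apply: DZ.
  split=> // g x /DC Dx.
    pose T : set (C \ox C)%type := [set t | D (tsum (fun a b => (g a : K) *: b) t)].
    suff : T (comul x) by [].
    apply: Defs.span_sub Dx => [|_ [a Da [b Db <-]]].
      apply/is_submodP; split; rewrite /T /=.
        by rewrite tsum_arg0; [|lin].
      by move=> a s t Ds Dt; rewrite tsum_linear; [apply: DZ|lin].
    by rewrite /T /= tsum_tensE; [apply: DZ'|lin].
  pose T : set (C \ox C)%type := [set t | D (tsum (fun a b => (g b : K) *: a) t)].
  suff : T (comul x) by [].
  apply: Defs.span_sub Dx => [|_ [a Da [b Db <-]]].
    apply/is_submodP; split; rewrite /T /=.
      by rewrite tsum_arg0; [|lin].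
    by move=> a s t Ds Dt; rewrite tsum_linear; [apply: DZ|lin].
  by rewrite /T /= tsum_tensE; [apply: DZ'|lin].
split=> // x Dx; have [e De ee] := idempotent_ker DM.
have e0 t : (forall g, e (tsum (fun a b => (g a : K) *: b) t) = 0) -> tmap idfun e t = 0.
  move=> et; apply: tens_separated_l => f; rewrite tsum_tmap; [|by lin..].
  by rewrite -[RHS](et f) linear_tsum; apply: eq_tsum => a b; rewrite linearZ_LR.
have e0' t : (forall g, e (tsum (fun a b => (g b : K) *: a) t) = 0) -> tmap e idfun t = 0.
  move=> et; apply: tens_separated_r => f; rewrite tsum_tmap; [|by lin..].
  by rewrite -[RHS](et f) linear_tsum; apply: eq_tsum => a b; rewrite linearZ_LR.
have {}e0 : tmap idfun e (comul x) = 0 by apply: e0 => g; apply/De/Dl.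
have {}e0' : tmap e idfun (comul x) = 0 by apply: e0' => g; apply/De/Dr.
rewrite /preimage /=.
have -> : comul x = tsum (fun a b => (a - e a) \ox (b - e b)) (comul x).
  transitivity (comul x - tmap e idfun (comul x) - tmap idfun e (comul x)
     + tmap e idfun (tmap idfun e (comul x))).
    by rewrite e0 e0' [tmap e idfun 0]linear0 !subr0 addr0.
  move: (comul x); apply: tens_ext => [||a b]; [by lin..|].
  rewrite !tmapE tsum_tensE /=; last by lin.
  by rewrite tensBl !tensBr opprD opprK addrA; congr (_ + _); rewrite addrAC.
have /is_submodP[S0 SZ] := span_submod [set y \ox z | y in D & z in D].
rewrite /tsum; elim/big_ind: _ => [//|s t Ss St|p _].
  by rewrite -[s]scale1r; apply: SZ.
by apply: Defs.sub_span; exists (p.1 - e p.1); [|exists (p.2 - e p.2)];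
    rewrite ?De ?linearB /= ?ee ?subrr.
Qed.

End Translates.

(** * Simple subcomodules modulo a subcoalgebra and their coefficients *)

Section Coradical.
Variables (K : fieldType) (C : coalgType K) (D : set C).
Hypothesis D_stable : tr_stable D.
Implicit Types (f g h : {linear C -> K^o}) (x y m : C).

Let DM : is_submod D. Proof. by case: D_stable. Qed.
Let Dl g x : D x -> D (ltr g x). Proof. by case: D_stable => _ + _; apply. Qed.
Let Dr g x : D x -> D (rtr g x). Proof. by case: D_stable => _ _; apply. Qed.

(* Modulo [D], the element [m] generates a simple left comodule. *)
Definition simple_mod m := ~ D m /\
  forall g, ~ D (ltr g m) -> exists h, D (ltr h (ltr g m) - m).

(** Descent on the dimension: the translates of [y] modulo [D] lie in the span of [n] vectors. If
    [y] is not simple, some translate [ltr g y] outside [D] has translates that never return to [y]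
    modulo [D]; they lie in a proper subspace, and [n] decreases. *)
Lemma simple_mod_exists x : ~ D x -> exists m, simple_mod m.
Proof.
have [e De ee] := idempotent_ker DM.
have DB a b : e a = e b <-> D (a - b).
  rewrite De linearB /=; split=> [->|/eqP]; first exact: subrr.
  by rewrite subr_eq0 => /eqP.
have main n (v : 'I_n -> C) y : ~ D y -> (forall g, lincomb v (e (ltr g y))) ->
    exists m, simple_mod m.
  elim: n v y => [|n IHn] v y Dy yv.
    case: Dy; apply/De; have [a] := yv counit.
    by rewrite big_ord0 ltr_counit.
  have [ys|] := pselect (simple_mod y); first by exists y.
  move=> /not_andP[//|/existsNP[g /not_implyP[Dgy /forallNP gy]]].
  pose T : set C := [set z | exists h, z = e (ltr h (ltr g y))].
  have [||||w Tw] := @lincomb_proper _ _ _ v T (e y).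
  - apply/is_submodP; split=> [|a _ _ [h ->] [k ->]].
      have [k kE] := @ltr_lincomb K C (-1) counit counit.
      by exists k; rewrite kE scaleN1r addNr linear0.
    have [f fE] := ltr_lincomb a h k.
    by exists f; rewrite fE linearP.
  - by move=> _ [h ->]; rewrite ltr_ltr; apply: yv.
  - by have := yv counit; rewrite ltr_counit.
  - by case=> h /esym/DB; apply: gy.
  - by apply: (IHn w (ltr g y)) => // h; apply: Tw; exists h.
(* Local finiteness: all translates of [x] are combinations of the right factors of one expression
   of [comul x]. *)
move=> Dx; have [n [u [v xE]]] := tens_sum_ordP (comul x).
apply: (main n (fun i => e (v i)) x Dx) => g; exists (fun i => g (u i)).
have L : linear (tsum (fun a b => (g a : K) *: e b)) by lin.
rewrite /ltr linear_tsum xE.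
transitivity (lin L (\sum_i u i \ox v i)); last first.
  by rewrite linear_sum; apply: eq_bigr => i _; rewrite linE tsum_tensE//; lin.
by rewrite linE; apply: eq_tsum => a b; rewrite linearZ_LR.
Qed.

Variable m : C.
Hypothesis ms : simple_mod m.

Definition annihilates f := forall x, D x -> f x = 0.

Lemma rtr_annihilates f x : annihilates f -> D x -> rtr f x = 0.
Proof.
move=> fD Dx; apply: functional_separated => g.
by rewrite pairing_tr fD //; apply: Dl.
Qed.

(* The coefficients of the simple comodule generated by [m], filtered by the
   number of summands. *)
Fixpoint coeffs n x : Prop :=
  if n is n'.+1 then
    exists f g y, [/\ annihilates f, coeffs n' y & x = rtr f (ltr g m) + y]
  else x = 0.

Definition coeff : set C := [set x | exists n, coeffs n x].

Lemma coeffs_ltr n h x : coeffs n x -> coeffs n (ltr h x).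
Proof.
elim: n x => [x ->|n IHn x [f [g [y [fD ny ->]]]]] /=; first by rewrite linear0.
exists f, (h \o ltr g), (ltr h y); split=> //; first exact: IHn.
by rewrite linearD /= ltr_rtr ltr_ltr.
Qed.

Lemma coeffs_rtr n h x : coeffs n x -> coeffs n (rtr h x).
Proof.
elim: n x => [x ->|n IHn x [f [g [y [fD ny ->]]]]] /=; first by rewrite linear0.
exists (h \o rtr f), g, (rtr h y); split=> //; last by rewrite linearD /= rtr_rtr.
  by move=> z Dz /=; rewrite rtr_annihilates// linear0.
exact: IHn.
Qed.

Lemma coeffsZ n a x : coeffs n x -> coeffs n (a *: x).
Proof.
elim: n x => [x ->|n IHn x [f [g [y [fD ny ->]]]]] /=; first by rewrite scaler0.
(* This makes [ltr k] equal to [a *: ltr g], as [(a - 1) + 1 = a]. *)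
have [k kE] := ltr_lincomb (a - 1) g g.
exists f, k, (a *: y); split=> //; first exact: IHn.
by rewrite kE scalerBl scale1r subrK linearZ_LR scalerDr.
Qed.

Lemma coeffsD n k x y : coeffs n x -> coeffs k y -> coeffs (n + k) (x + y).
Proof.
elim: n x => [x -> ky|n IHn x [f [g [z [fD nz ->]]]] ky] /=; first by rewrite add0r.
by exists f, g, (z + y); split=> //; [apply: IHn|rewrite addrA].
Qed.

Lemma coeff_stable : tr_stable coeff.
Proof.
split; last 2 first.
- by move=> g x [n nx]; exists n; apply: coeffs_ltr.
- by move=> g x [n nx]; exists n; apply: coeffs_rtr.
apply/is_submodP; split; first by exists 0%N.
move=> a x y [n nx] [k ky]; exists (n + k)%N; apply: coeffsD => //.
exact: coeffsZ.
Qed.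

(* A shortest nonzero element of a subcoalgebra of [coeff] generates [coeff]:
   applying [ltr] to it amounts to applying [ltr] to its first summand. *)
Lemma coeff_min D' : tr_stable D' ->
  forall n x, coeffs n x -> D' x -> x <> 0 -> coeff `<=` D'.
Proof.
move=> [D'M D'l D'r]; have /is_submodP[D'0 D'Z] := D'M.
elim=> [//|n IHn] x [f1 [g1 [y1 [f1D ny1 xE]]]] D'x x0.
set n1 := ltr g1 m.
(* A translation that kills the first summand but not [x] yields a nonzero element of [D'] with
   fewer summands. *)
have [[g [Dgn gx]]|shortest] := pselect (exists g, D (ltr g n1) /\ ltr g x <> 0).
  apply: (IHn (ltr g x)) => //; last exact: D'l.
  rewrite xE linearD /= ltr_rtr rtr_annihilates// add0r.
  exact: coeffs_ltr.
have {}shortest g : D (ltr g n1) -> ltr g x = 0.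
  by move=> Dg; apply: contrapT => gx; apply: shortest; exists g.
have [h1 Dh1] : exists h, D (ltr h n1 - m).
  case: ms => _; apply => Dn1; apply: x0.
  by rewrite -[x]ltr_counit; apply: shortest; rewrite ltr_counit.
have regular g : ltr g x = 0 -> D (ltr g n1).
  move=> gx; apply: contrapT => Dgn.
  have [h2 Dh2] : exists h, D (ltr h (ltr g n1) - m).
    case: ms => _ /(_ (g \o ltr g1)); rewrite -ltr_ltr; exact.
  (* If [ltr g n1] were outside [D], simplicity would bring it back to [m] by [h2], and then to [n1]
     by [g1]. So [k], the round trip minus the identity, sends [n1] into [D] and hence kills [x];
     since [ltr g x = 0], this says [x = 0]. *)
  have [k kE] := ltr_lincomb (-1) counit (g1 \o ltr (h2 \o ltr g)).
  apply: x0; have : ltr k x = 0.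
    apply: shortest; rewrite kE ltr_counit -!ltr_ltr addrC scaleN1r.
    by rewrite -[n1 in X in _ - X]/(ltr g1 m) -linearB; apply: Dl.
  rewrite kE -!ltr_ltr gx !linear0 addr0 ltr_counit scaleN1r.
  by move/eqP; rewrite oppr_eq0 => /eqP.
have n1D' f : annihilates f -> D' (rtr f n1).
  move=> fD.
  (* By [regular], the value [f (ltr g n1)] depends only on [ltr g x]; a functional [h] with these
     values realises [rtr f n1] as the translate [rtr h x]. *)
  pose G : set (C * K^o) := [set u | exists g, u = (ltr g x, f (ltr g n1))].
  have [||h hG] := @total_extension _ _ _ G.
  - apply/is_submodP; split.
      have [k kE] := @ltr_lincomb K C (-1) counit counit.
      by exists k; rewrite !kE !scaleN1r !addNr linear0.
    move=> a _ _ [g ->] [g' ->]; have [k kE] := ltr_lincomb a g g'.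
    by exists k; rewrite !kE linearP.
  - by move=> z [g [/esym/regular/fD + ->]].
  suff -> : rtr f n1 = rtr h x by apply: D'r.
  apply/eqP; rewrite -subr_eq0; apply/eqP/functional_separated => g.
  by rewrite linearB !pairing_tr (hG _ (f (ltr g n1))) ?subrr//; exists g.
move=> z [k]; elim: k z => [_ -> //|k IHk z [f [g [y [fD ky ->]]]]].
rewrite -[X in X + _]scale1r; apply: D'Z; last exact: IHk.
(* Modulo [D], which [rtr f] kills, [m] is the translate [ltr h1 n1]; coefficients of [m] are thus
   translates of coefficients of [n1]. *)
suff -> : rtr f (ltr g m) = ltr g (ltr h1 (rtr f n1)) by apply/D'l/D'l/n1D'.
rewrite !ltr_rtr; have := rtr_annihilates fD (Dl g Dh1).
by rewrite 2!linearB /= => /eqP; rewrite subr_eq0 => /eqP.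
Qed.

(** If nonzero, [coeff] is a simple subcoalgebra: by [coeff_min] any nonzero subcoalgebra inside it
    exhausts it. *)
Lemma coeff_corad : corad C `<=` D -> coeff `<=` D.
Proof.
move=> CD x cx; have [->|/eqP x0] := eqVneq x 0; first by case/is_submodP: DM.
apply: CD; apply: Defs.sub_span; exists coeff => //; split.
- exact/subcoalgebraP/coeff_stable.
- by move=> c0; apply: x0; rewrite c0 in cx.
move=> D' /subcoalgebraP D's D'c.
have [D'0|/existsNP[y /not_implyP[D'y y0]]] := pselect (forall y, D' y -> y = 0).
  left; apply/seteqP; split=> // y ->; case: D's => /is_submodP[]//.
right; apply/seteqP; split=> //; have [n ny] := D'c _ D'y.
exact: coeff_min D's _ _ ny D'y y0.
Qed.

End Coradical.

(* If [D] is a proper subcoalgebra containing the coradical, then the comodule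
   [C / D] has a simple subcomodule; its coefficient coalgebra is simple, hence
   lies in [D], so that [D] differs from the wedge [D /\ D]. *)
Lemma wedge_closed_full (K : fieldType) (C : coalgType K) (D : set C)
    (e : {linear C -> C}) :
  tr_stable D -> (forall x, D x <-> e x = 0) -> corad C `<=` D ->
  (forall x, tmap e e (comul x) = 0 -> D x) -> forall x, D x.
Proof.
move=> Ds De CD wD x; apply: contrapT => Dx.
have [m ms] := simple_mod_exists Ds Dx.
(* Separation reduces membership of [m] in the wedge to [rtr (f \o e) m] lying in [D]; this is a
   coefficient with one summand, because [f \o e] kills [D]. *)
case: (ms) => Dm _; apply/Dm/wD; apply: tens_separated_r => f.
rewrite tsum_tmap; [|by lin..].
transitivity (e (rtr (f \o e) m)).
  by rewrite /rtr linear_tsum; apply: eq_tsum => a b; rewrite linearZ_LR.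
apply/De/(coeff_corad Ds ms CD); exists 1%N, (f \o e), counit, 0; split=> //.
  by move=> y /De ey /=; rewrite ey linear0.
by rewrite ltr_counit addr0.
Qed.
(** * Retractions of coactions *)

Section OneSidedCofree.
Variables (K : fieldType) (C : coalgType K) (M : bicomodType C).

(** [C \ox M] coacts on the left through [C] and on the right through [M], so that [lcoact] becomes
    a bicomodule map from [M] into it. *)
Definition lcofree_lcoact : (C \ox M)%type -> (C \ox (C \ox M))%type :=
  @tassoc K C C M \o tmap comul idfun.
Definition lcofree_rcoact : (C \ox M)%type -> ((C \ox M) \ox C)%type :=
  @tassocV K C M C \o tmap idfun rcoact.

HB.instance Definition _ := GRing.Linear.on lcofree_lcoact.
HB.instance Definition _ := GRing.Linear.on lcofree_rcoact.

Lemma lcofree_lcoactE c m : lcofree_lcoact (c \ox m) = tassoc (comul c \ox m).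
Proof. by rewrite /lcofree_lcoact /= tmapE. Qed.

Lemma lcofree_rcoactE c m : lcofree_rcoact (c \ox m) = tassocV (c \ox rcoact m).
Proof. by rewrite /lcofree_rcoact /= tmapE. Qed.

Lemma lcofree_lcoactA t : tassoc (tmap comul idfun (lcofree_lcoact t)) =
  tmap idfun lcofree_lcoact (lcofree_lcoact t).
Proof.
move: t; apply: tens_ext => [||c m]; [by lin..|].
rewrite lcofree_lcoactE.
transitivity (tmap idfun (@tassoc K C C M) (tassoc (tmap idfun comul (comul c) \ox m))).
  rewrite -comulA; move: (comul c); apply: tens_ext => [||a b]; [by lin..|].
  rewrite !tensorE /= ?tensorE; move: (comul a).
  by apply: tens_ext => [||x y]; [by lin..|]; rewrite !tensorE /= ?tensorE.
move: (comul c); apply: tens_ext => [||a b]; [by lin..|].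
by rewrite !tensorE /= ?tensorE lcofree_lcoactE.
Qed.

Lemma lcofree_lcoact_counit t : tlunit (tmap counit idfun (lcofree_lcoact t)) = t.
Proof.
move: t; apply: tens_ext => [||c m]; [by lin..|].
rewrite lcofree_lcoactE -[in RHS](comul_counitl c).
move: (comul c); apply: tens_ext => [||a b]; [by lin..|].
by rewrite !tensorE /= ?tensorE tensZl.
Qed.

Lemma lcofree_rcoactA t : tassoc (tmap lcofree_rcoact idfun (lcofree_rcoact t)) =
  tmap idfun comul (lcofree_rcoact t).
Proof.
move: t; apply: tens_ext => [||c m]; [by lin..|].
rewrite lcofree_rcoactE.
transitivity (tassocV (c \ox tassoc (tmap rcoact idfun (rcoact m)))).
  move: (rcoact m); apply: tens_ext => [||n b]; [by lin..|].
  rewrite !tensorE /= ?tensorE lcofree_rcoactE; move: (rcoact n).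
  by apply: tens_ext => [||p q]; [by lin..|]; rewrite !tensorE /= ?tensorE.
rewrite rcoactA; move: (rcoact m); apply: tens_ext => [||n b]; [by lin..|].
by rewrite !tensorE /= ?tensorE.
Qed.

Lemma lcofree_rcoact_counit t : trunit (tmap idfun counit (lcofree_rcoact t)) = t.
Proof.
move: t; apply: tens_ext => [||c m]; [by lin..|].
rewrite lcofree_rcoactE -[in RHS](rcoact_counit m).
move: (rcoact m); apply: tens_ext => [||a b]; [by lin..|].
by rewrite !tensorE /= ?tensorE tensZr.
Qed.

Lemma lcofree_lrcoactA t : tassoc (tmap lcofree_lcoact idfun (lcofree_rcoact t)) =
  tmap idfun lcofree_rcoact (lcofree_lcoact t).
Proof.
move: t; apply: tens_ext => [||c m]; [by lin..|].
rewrite lcofree_lcoactE lcofree_rcoactE.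
transitivity (tassoc (tmap (@tassoc K C C M) idfun (tassocV (comul c \ox rcoact m)))).
  move: (rcoact m); apply: tens_ext => [||n b]; [by lin..|].
  by rewrite !tensorE /= ?tensorE lcofree_lcoactE.
move: (comul c); apply: tens_ext => [||x y]; [by lin..|].
rewrite !tensorE /= ?tensorE lcofree_rcoactE; move: (rcoact m).
apply: tens_ext => [||a b]; [by lin..|].
by rewrite !tensorE /= ?tensorE.
Qed.

Definition lcofree : bicomodType C :=
  HB.pack_for (bicomodType C) (C \ox M)%type
    (Lmodule_isBicomodule.Build K C (C \ox M)%type
      lcofree_lcoactA lcofree_lcoact_counit lcofree_rcoactA lcofree_rcoact_counit
      lcofree_lrcoactA).

Lemma lcofree_lcoact_lcoact (x : M) : lcofree_lcoact (lcoact x) = tmap idfun lcoact (lcoact x).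
Proof. exact: lcoactA. Qed.

Lemma lcofree_rcoact_lcoact (x : M) : lcofree_rcoact (lcoact x) = tmap lcoact idfun (rcoact x).
Proof. exact: (etrans (congr1 (@tassocV K C M C) (esym (lrcoactA x))) (tassocK _)). Qed.

(** The bicomodule map [lcoact] has the linear retraction [eps \ox id], so relative injectivity
    extends the identity of [M] along it. *)
Lemma lcoact_retraction : rel_injective M ->
  exists s : {linear (C \ox M)%type -> M},
    [/\ forall t, lcoact (s t) = tmap idfun s (lcofree_lcoact t),
        forall t, rcoact (s t) = tmap s idfun (lcofree_rcoact t) &
        forall x, s (lcoact x) = x].
Proof.
move=> Minj.
have iM : @bicomod_morphism K C M lcofree (@lcoact _ _ M).
  split; [exact: lcofree_lcoact_lcoact|exact: lcofree_rcoact_lcoact].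
have idM : @bicomod_morphism K C M M idfun.
  split=> x; first by move: (lcoact x); apply: tens_ext => [||a b]; [by lin..|]; rewrite tmapE.
  by move: (rcoact x); apply: tens_ext => [||a b]; [by lin..|]; rewrite tmapE.
have rM : exists r : {linear lcofree -> M}, cancel (@lcoact _ _ M) r.
  exists (@tlunit K M \o @tmap K C K^o M M counit idfun); exact: lcoact_counit.
have [s [[sl sr] si]] := Minj _ _ _ _ iM rM idM.
exists s; split; [exact: sl|exact: sr|exact: si].
Qed.

End OneSidedCofree.
(** * Extending coalgebra maps to the wedge *)

Section Wedge.
Variables (K : fieldType) (E : coalgType K).

Lemma comul_ltr (g : {linear E -> K^o}) x :
  comul (ltr g x) = tmap (ltr g) idfun (comul x).
Proof.
rewrite /ltr linear_tsum.
transitivity (tsum (fun a b : E => tsum (fun c d => ((g a : K) *: c) \ox d) (comul b)) (comul x)).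
  by apply: eq_tsum => a b; rewrite linearZ_LR -[comul b in LHS]tsum_tens -tsumZ;
      apply: eq_tsum => c d; rewrite tensZl.
rewrite -(tsum_coassoc (F := fun a c d : E => ((g a : K) *: c) \ox d)); [|by lin..].
move: (comul x); apply: tens_ext => [||a b]; [by lin..|].
rewrite tmapE tsum_tensE /= /ltr; last by lin.
move: (comul a); apply: tens_ext => [||c d]; [by lin..|].
by rewrite !tsum_tensE ?tensZl//; lin.
Qed.

Lemma comul_rtr (g : {linear E -> K^o}) x :
  comul (rtr g x) = tmap idfun (rtr g) (comul x).
Proof.
rewrite /rtr linear_tsum.
transitivity (tsum (fun a b : E => tsum (fun c d => ((g b : K) *: c) \ox d) (comul a)) (comul x)).
  by apply: eq_tsum => a b; rewrite linearZ_LR -[comul a in LHS]tsum_tens -tsumZ;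
      apply: eq_tsum => c d; rewrite tensZl.
rewrite (tsum_coassoc (F := fun c d b : E => ((g b : K) *: c) \ox d)); [|by lin..].
move: (comul x); apply: tens_ext => [||a b]; [by lin..|].
rewrite tmapE tsum_tensE /= /rtr; last by lin.
move: (comul b); apply: tens_ext => [||c d]; [by lin..|].
by rewrite !tsum_tensE ?tensZr ?tensZl//; lin.
Qed.

(** For [x] in a subcoalgebra both Sweedler factors may be taken there, although the chosen
    representation of [comul x] need not have this property. *)
Lemma stable_tsum0 (W : lmodType K) (D : set E) (G : E -> E -> W) x :
  tr_stable D -> D x -> (forall b, linear (G^~ b)) -> (forall a, linear (G a)) ->
  (forall a b, D a -> D b -> G a b = 0) -> tsum G (comul x) = 0.
Proof.
move=> /subcoalgebraP[_ DC] /DC Dx Gl Gr G0.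
pose T : set (E \ox E)%type := [set t | tsum G t = 0].
suff : T (comul x) by [].
apply: Defs.span_sub Dx => [|_ [a Da [b Db <-]]].
  apply/is_submodP; split=> [|a s t]; first by rewrite /T /= tsum_arg0; [|lin].
  by rewrite /T /= => s0 t0; rewrite tsum_linear; [rewrite s0 t0 scaler0 addr0|lin].
by rewrite /T /= tsum_tensE; [apply: G0|lin].
Qed.

Lemma stable_eq_tsum (W : lmodType K) (D : set E) (G G' : E -> E -> W) x :
  tr_stable D -> D x -> (forall b, linear (G^~ b)) -> (forall a, linear (G a)) ->
  (forall b, linear (G'^~ b)) -> (forall a, linear (G' a)) ->
  (forall a b, D a -> D b -> G a b = G' a b) -> tsum G (comul x) = tsum G' (comul x).
Proof.
move=> Ds Dx Gl Gr Gl' Gr' GG'; apply/eqP; rewrite -subr_eq0 -tsumB; apply/eqP.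
by apply: (stable_tsum0 Ds Dx) => [b|a|a b Da Db]; [by lin|by lin|]; rewrite GG'// subrr.
Qed.

Variable e : {linear E -> E}.
Hypothesis eK : forall x, e (e x) = e x.
Definition ker : set E := [set x | e x = 0].
(** As [e] embeds [E / ker e] into [E], this is the kernel of [E -> E / ker e \ox E / ker e], the
    wedge of [ker e] with itself. *)
Definition wedge : set E := [set x | tmap e e (comul x) = 0].
Hypothesis ker_stable : tr_stable ker.

(* Bilinear maps killing [ker] in either variable factor through [e \ox e]. *)
Lemma wedge_tsum0 (W : lmodType K) (G : E -> E -> W) x :
  wedge x -> (forall b, linear (G^~ b)) -> (forall a, linear (G a)) ->
  (forall a b, ker a -> G a b = 0) -> (forall a b, ker b -> G a b = 0) ->
  tsum G (comul x) = 0.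
Proof.
move=> xw Gl Gr G0l G0r.
transitivity (tsum G (tmap e e (comul x))); last by rewrite xw tsum_arg0.
have kerB a : ker (a - e a) by rewrite /ker /= linearB /= eK subrr.
rewrite tsum_tmap//; apply: eq_tsum => a b; apply/eqP.
have /eqP := G0l _ (e b) (kerB a); have /eqP := G0r a _ (kerB b).
rewrite -[G a _](linE (Gr a)) linearB -[G _ (e b)](linE (Gl (e b))) linearB !linE !subr_eq0.
by move=> /eqP-> /eqP->.
Qed.

Lemma wedge_eq_tsum (W : lmodType K) (G G' : E -> E -> W) x :
  wedge x -> (forall b, linear (G^~ b)) -> (forall a, linear (G a)) ->
  (forall b, linear (G'^~ b)) -> (forall a, linear (G' a)) ->
  (forall a b, ker a -> G a b = G' a b) -> (forall a b, ker b -> G a b = G' a b) ->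
  tsum G (comul x) = tsum G' (comul x).
Proof.
move=> xw Gl Gr Gl' Gr' GGl GGr; apply/eqP; rewrite -subr_eq0 -tsumB; apply/eqP.
by apply: (wedge_tsum0 xw) => [b|a|a b ka|a b kb];
  [by lin|by lin|rewrite GGl ?subrr|rewrite GGr ?subrr].
Qed.

Lemma ker_wedge : ker `<=` wedge.
Proof.
move=> x kx; rewrite /wedge /= -[comul x]tsum_tens linear_tsum.
apply: (stable_tsum0 ker_stable kx) => [b|a|a b /= ka kb]; [by lin|by lin|].
by rewrite tmapE ka tens0l.
Qed.

Lemma wedge_stable : tr_stable wedge.
Proof.
split=> [|g x wx|g x wx].
- apply/is_submodP; rewrite /wedge /=; split; first by rewrite !linear0.
  by move=> a x y x0 y0; rewrite !linearP /= x0 y0 scaler0 addr0.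
- rewrite /wedge /= comul_ltr -[comul x]tsum_tens !linear_tsum.
  case: ker_stable => _ kl _.
  apply: (wedge_tsum0 wx) => [b|a|a b ka|a b kb]; [by lin|by lin|..];
    rewrite /= !tmapE /=; last by rewrite kb tens0r.
  by have := kl g _ ka; rewrite /ker /= => ->; rewrite tens0l.
- rewrite /wedge /= comul_rtr -[comul x]tsum_tens !linear_tsum.
  case: ker_stable => _ _ kr.
  apply: (wedge_tsum0 wx) => [b|a|a b ka|a b kb]; [by lin|by lin|..];
    rewrite /= !tmapE /=; first by rewrite ka tens0l.
  by have := kr g _ kb; rewrite /ker /= => ->; rewrite tens0r.
Qed.

End Wedge.

(** * Correcting a linear extension to a coalgebra map *)

Section CoalgebraExtension.
Variables (K : fieldType) (E H : coalgType K) (M : bicomodType H).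
Variables (pr : {linear (H \ox H)%type -> M}) (tau : {linear M -> H}).
Variable sigma : {linear (H \ox M)%type -> M}.
Hypothesis pr_surj : forall y, exists t, y = pr t.
Hypothesis pr_ker : forall t, pr t = 0 <-> exists h, t = comul h.
Hypothesis lcoact_pr : forall x y,
  lcoact (pr (x \ox y)) = tsum (fun h k => h \ox pr (k \ox y)) (comul x).
Hypothesis rcoact_pr : forall x y,
  rcoact (pr (x \ox y)) = tsum (fun h k => pr (x \ox h) \ox k) (comul y).
Hypothesis tauE : forall x y,
  tau (pr (x \ox y)) = (counit x : K) *: y - (counit y : K) *: x.
Hypothesis lcoact_sigma : forall h m,
  lcoact (sigma (h \ox m)) = tsum (fun a b => a \ox sigma (b \ox m)) (comul h).
Hypothesis rcoact_sigma : forall h m,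
  rcoact (sigma (h \ox m)) = tsum (fun n a => sigma (h \ox n) \ox a) (rcoact m).
Hypothesis sigma_lcoact : forall y, sigma (lcoact y) = y.

Variables (e : {linear E -> E}) (q : {linear E -> H}).
Hypothesis eK : forall x, e (e x) = e x.
Hypothesis ker_stable : tr_stable (ker e).
Hypothesis q_comul : forall x, ker e x -> comul (q x) = tmap q q (comul x).
Hypothesis q_counit : forall x, counit (q x) = counit x.

Lemma counit_tau y : counit (tau y) = 0.
Proof.
have [t ->] := pr_surj y; move: t; apply: tens_ext => [||a b]; [by lin..|].
by rewrite tauE linearB !(linearZ_LR counit) /= [_ *: _]mulrC subrr.
Qed.

(** The second term of [tau] contributes a multiple of [pr (comul a) = 0]. *)
Lemma pr_tau_lcoact y : pr (tmap idfun tau (lcoact y)) = y.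
Proof.
have [t ->] := pr_surj y; move: t; apply: tens_ext => [||a b]; [by lin..|].
rewrite lcoact_pr !linear_tsum.
transitivity (tsum (fun h k => (counit k : K) *: pr (h \ox b)) (comul a)
   - (counit b : K) *: tsum (fun h k => pr (h \ox k)) (comul a)).
  rewrite -tsumZ -tsumB; apply: eq_tsum => h k.
  by rewrite /= tmapE /= tauE tensBr linearB !tensZr !linearZ_LR.
rewrite (tsum_counitr (f := fun h => pr (h \ox b))); last by lin.
rewrite -linear_tsum tsum_tens (pr_ker (comul a)).2 ?scaler0 ?subr0//.
by exists a.
Qed.

(** Here the first term of [tau] dies and the second survives, whence the sign. *)
Lemma pr_tau_rcoact y : pr (tmap tau idfun (rcoact y)) = - y.
Proof.
have [t ->] := pr_surj y; move: t; apply: tens_ext => [||a b]; [by lin..|].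
rewrite rcoact_pr !linear_tsum.
transitivity ((counit a : K) *: tsum (fun h k => pr (h \ox k)) (comul b)
   - tsum (fun h k => (counit h : K) *: pr (a \ox k)) (comul b)).
  rewrite -tsumZ -tsumB; apply: eq_tsum => h k.
  by rewrite /= tmapE /= tauE tensBl linearB !tensZl !linearZ_LR.
rewrite (tsum_counitl (f := fun k => pr (a \ox k))); last by lin.
rewrite -linear_tsum tsum_tens (pr_ker (comul b)).2 ?scaler0 ?sub0r//.
by exists b.
Qed.

(* On [wedge e], [w] is left colinear and [z] is right colinear, so that both
   parts of [F = w + z] lift along [pr]. *)
Let F x : M := tsum (fun a b => pr (q a \ox q b)) (comul x).
Let w x : M := tsum (fun a b => sigma (q a \ox F b)) (comul x).
Let z x : M := F x - w x.
Let lam x : H := tau (w x).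

Let F_linear : linear F. Proof. by rewrite /F; lin. Qed.
Let w_linear : linear w. Proof. by rewrite /w; lin. Qed.
Let z_linear : linear z. Proof. by rewrite /z; lin. Qed.
Let lam_linear : linear lam. Proof. by rewrite /lam; lin. Qed.

Let F_ker x : ker e x -> F x = 0.
Proof.
move=> kx; rewrite /F -(@tsum_tmap _ _ _ _ _ _ q q (fun u v => pr (u \ox v))); [|by lin..].
rewrite -linear_tsum tsum_tens -q_comul//; apply/pr_ker.
by exists (q x).
Qed.

Let w_ker x : ker e x -> w x = 0.
Proof.
move=> kx; apply: (stable_tsum0 ker_stable kx) => [b|a|a b _ kb]; [by lin|by lin|].
by rewrite F_ker// tens0r linear0.
Qed.

Let lam_ker x : ker e x -> lam x = 0.
Proof. by move=> kx; rewrite /lam w_ker// linear0. Qed.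

Let Z (t : (H \ox H)%type) y : M := tsum (fun h k => sigma (h \ox pr (k \ox y))) t.
Let theta x : (H \ox H)%type := comul (q x) - tmap q q (comul x).

Let Z_linearl y : linear (Z^~ y). Proof. by rewrite /Z; lin. Qed.
Let Z_linearr t : linear (Z t). Proof. by rewrite /Z; lin. Qed.
Let theta_linear : linear theta. Proof. by rewrite /theta; lin. Qed.

Let theta_ker x : ker e x -> theta x = 0.
Proof. by move=> kx; rewrite /theta q_comul// subrr. Qed.

(** Writing [F x] as [sigma (lcoact (F x))] expresses [z] through the defect [theta], which vanishes
    on [ker e]; this is what the right coaction needs. *)
Let zE x : z x = tsum (fun a b => Z (theta a) (q b)) (comul x).
Proof.
transitivity (tsum (fun a b => Z (comul (q a)) (q b)) (comul x) -
   tsum (fun a b => Z (tmap q q (comul a)) (q b)) (comul x)); last first.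
  rewrite -tsumB; apply: eq_tsum => a b.
  by rewrite -!(linE (Z_linearl (q b))) -linearB.
congr (_ - _).
  rewrite -[LHS]sigma_lcoact /F !linear_tsum; apply: eq_tsum => a b.
  by rewrite lcoact_pr linear_tsum.
rewrite /w; transitivity (tsum (fun a b =>
    tsum (fun c d => sigma (q a \ox pr (q c \ox q d))) (comul b)) (comul x)).
  by apply: eq_tsum => a b; rewrite /F tsum_tensr linear_tsum.
rewrite -(tsum_coassoc (F := fun a c d => sigma (q a \ox pr (q c \ox q d)))); [|by lin..].
by apply: eq_tsum => a b; rewrite /Z tsum_tmap; [|by lin..].
Qed.

(** On the wedge [comul (q a)] may be replaced by the image of [comul a] under [q \ox q]: for [a] in
    [ker e] they agree, and for [b] in [ker e] the factor [F b] vanishes. *)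
Let w_lcoact x : wedge e x -> lcoact (w x) = tsum (fun a b => q a \ox w b) (comul x).
Proof.
move=> wx; rewrite /w linear_tsum.
transitivity (tsum (fun a b =>
  tsum (fun h k => h \ox sigma (k \ox F b)) (tmap q q (comul a))) (comul x)).
  apply: (wedge_eq_tsum eK wx) => [b|a|b|a|a b ka|a b kb]; [by lin..| |].
    by rewrite lcoact_sigma q_comul.
  rewrite F_ker// tens0r !linear0; apply/esym/big1 => p _.
  by rewrite tens0r linear0 tens0r.
transitivity (tsum (fun a b => tsum (fun c d => q c \ox sigma (q d \ox F b)) (comul a)) (comul x)).
  by apply: eq_tsum => a b; rewrite tsum_tmap; [|by lin..].
rewrite (tsum_coassoc (F := fun c d b => q c \ox sigma (q d \ox F b))); [|by lin..].
by apply: eq_tsum => a b; rewrite tsum_tensr.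
Qed.

(** The mirror argument: now [comul (q b)] is replaced, with [theta a] in the role of [F b]. *)
Let z_rcoact x : wedge e x -> rcoact (z x) = tsum (fun a b => z a \ox q b) (comul x).
Proof.
move=> wx; rewrite zE linear_tsum.
transitivity (tsum (fun a b => tsum (fun h k => Z (theta a) h \ox k) (comul (q b))) (comul x)).
  apply: eq_tsum => a b; rewrite /Z linear_tsum.
  transitivity (tsum (fun u v =>
      tsum (fun h k => sigma (u \ox pr (v \ox h)) \ox k) (comul (q b))) (theta a)).
    apply: eq_tsum => u v; rewrite rcoact_sigma rcoact_pr tsum_tsum; last by lin.
    by apply: eq_tsum => h k; rewrite tsum_tensE//; lin.
  by rewrite tsum_exchange; apply: eq_tsum => h k; rewrite tsum_tensl.
transitivity (tsum (fun a b =>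
  tsum (fun h k => Z (theta a) h \ox k) (tmap q q (comul b))) (comul x)).
  apply: (wedge_eq_tsum eK wx) => [b|a|b|a|a b ka|a b kb]; [by lin..| |].
    have Z0 y : Z 0 y = 0 by rewrite -(linE (Z_linearl y)) linear0.
    rewrite theta_ker//; transitivity (0 : (M \ox H)%type); [|apply/esym];
      by apply: big1 => p _; rewrite Z0 tens0l.
  by rewrite q_comul.
transitivity (tsum (fun a b => tsum (fun c d => Z (theta a) (q c) \ox q d) (comul b)) (comul x)).
  by apply: eq_tsum => a b; rewrite tsum_tmap; [|by lin..].
rewrite -(tsum_coassoc (F := fun a c d => Z (theta a) (q c) \ox q d)); [|by lin..].
by apply: eq_tsum => a b; rewrite zE tsum_tensl.
Qed.

(** The map is [q - lam]. In the expansion of its tensor square on [comul x], the mixed terms cancel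
    [F x] under [pr] and [lam \ox lam] vanishes on the wedge; the result is killed by [pr], hence of
    the form [comul h]. *)
Lemma comul_extension : exists2 q' : {linear E -> H},
  forall x, ker e x -> q' x = q x &
  (forall x, counit (q' x) = counit x) /\
  forall x, wedge e x -> comul (q' x) = tmap q' q' (comul x).
Proof.
have L : linear (fun x => q x - lam x) by lin.
exists (lin L) => [x kx|]; first by rewrite linE lam_ker// subr0.
have cL x : counit (lin L x) = counit x.
  by rewrite linE linearB /lam counit_tau subr0.
split=> // x wx.
have Fx : F x = pr (tsum (fun a b => q a \ox lam b + lam a \ox q b) (comul x)).
  (* Indeed [tau (F y) = q y - q y = 0], because [q] preserves the counit. *)
  have zw y : tau (z y) = - lam y.
    rewrite /z linearB /lam /F linear_tsum.
    transitivity (tsum (fun a b => (counit a : K) *: q b) (comul y)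
       - tsum (fun a b => (counit b : K) *: q a) (comul y) - tau (w y)).
      by rewrite -tsumB; congr (_ - _); apply: eq_tsum => a b; rewrite tauE !q_counit.
    by rewrite (tsum_counitl (f := q)) ?(tsum_counitr (f := q)) ?subrr ?sub0r//; lin.
  rewrite tsumD linearD.
  have -> : F x = w x + z x by rewrite /z addrC subrK.
  congr (_ + _).
    rewrite -[LHS]pr_tau_lcoact w_lcoact// linear_tsum; congr (pr _).
    by apply: eq_tsum => a b; rewrite /= tmapE.
  rewrite -[LHS]opprK -(pr_tau_rcoact (z x)) z_rcoact// linear_tsum -linearN -tsumN.
  by congr (pr _); apply: eq_tsum => a b; rewrite /= tmapE zw tensNl opprK.
have [h hE] : exists h, tmap (lin L) (lin L) (comul x) = comul h.
  apply/pr_ker; rewrite -[comul x]tsum_tens linear_tsum.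
  transitivity (pr (tsum (fun a b => q a \ox q b) (comul x)
      - tsum (fun a b => q a \ox lam b + lam a \ox q b) (comul x)
      + tsum (fun a b => lam a \ox lam b) (comul x))).
    rewrite -tsumB -tsumD; congr (pr _); apply: eq_tsum => a b.
    rewrite /= tmapE !linE tensBl !tensBr opprD opprK !addrA.
    by congr (_ + _); rewrite opprD addrA addrAC.
  rewrite linearD linearB -Fx linear_tsum subrr add0r.
  rewrite (wedge_tsum0 eK wx) ?linear0// => [b|a|a b ka|a b kb].
  - by lin.
  - by lin.
  - by rewrite (lam_ker ka) tens0l.
  - by rewrite (lam_ker kb) tens0r.
(* The element [h] is recovered from [comul h] by the counit on the left factor, which also returns
   [q' x] since [q'] preserves counits. *)
rewrite hE; congr (comul _); rewrite -[h in RHS]comul_counitl -hE.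
rewrite -[LHS](tsum_counitl (f := lin L)); last by lin.
move: (comul x); apply: tens_ext => [||a b]; [by lin..|].
by rewrite tsum_tensE ?tensorE ?cL//; lin.
Qed.

End CoalgebraExtension.
Lemma injective_extension (K : fieldType) (E H : coalgType K) (M : bicomodType H)
    (pr : {linear (H \ox H)%type -> M}) (e : {linear E -> E}) (q : {linear E -> H}) :
  rel_injective M ->
  (forall y, exists t, y = pr t) -> (forall t, pr t = 0 <-> exists h, t = comul h) ->
  (forall t, lcoact (pr t) = tmap idfun pr (cofree_lcoact t)) ->
  (forall t, rcoact (pr t) = tmap pr idfun (cofree_rcoact t)) ->
  (forall x, e (e x) = e x) -> tr_stable (ker e) ->
  (forall x, ker e x -> comul (q x) = tmap q q (comul x)) ->
  (forall x, counit (q x) = counit x) ->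
  exists2 q' : {linear E -> H},
    forall x, ker e x -> q' x = q x &
    (forall x, counit (q' x) = counit x) /\
    forall x, wedge e x -> comul (q' x) = tmap q' q' (comul x).
Proof.
move=> Minj pr_surj pr_ker lpr rpr eK ke qm qe.
have [s [sl sr sK]] := lcoact_retraction Minj.
pose t0 := tsum (fun x y : H => (counit x : K) *: y - (counit y : K) *: x).
have t0L : linear t0 by rewrite /t0; lin.
have [tau tauE] : exists tau : {linear M -> H}, forall t, tau (pr t) = t0 t.
  (* [t0] descends along [pr], since on [comul h] it gives [h - h = 0]. *)
  pose G : set (M * H) := [set u | exists t, u = (pr t, t0 t)].
  have [||tau tauG] := @total_extension _ _ _ G.
  - apply/is_submodP; split; first by exists 0; rewrite linear0 -(linE t0L) linear0.
    move=> a _ _ [x ->] [y ->]; exists (a *: x + y).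
    by rewrite linearP -!(linE t0L) linearP.
  - move=> y [t [/esym/pr_ker[h ->] ->]].
    rewrite /t0 tsumB.
    by rewrite (tsum_counitl (f := id)) ?(tsum_counitr (f := id)) ?subrr//; lin.
  - by exists tau => t; apply: tauG; exists t.
apply: (@comul_extension K E H M pr tau s) => //.
- move=> x y; rewrite lpr cofree_lcoactE.
  move: (comul x); apply: tens_ext => [||h k]; [by lin..|].
  by rewrite !tensorE tsum_tensE//; lin.
- move=> x y; rewrite rpr cofree_rcoactE.
  move: (comul y); apply: tens_ext => [||h k]; [by lin..|].
  by rewrite !tensorE tsum_tensE//; lin.
- by move=> x y; rewrite tauE /t0 tsum_tensE//; lin.
- move=> h m; rewrite sl /lcofree_lcoact /= tmapE.
  move: (comul h); apply: tens_ext => [||a b]; [by lin..|].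
  by rewrite !tensorE tsum_tensE//; lin.
- move=> h m; rewrite sr /lcofree_rcoact /= tmapE.
  move: (rcoact m); apply: tens_ext => [||a b]; [by lin..|].
  by rewrite !tensorE tsum_tensE//; lin.
Qed.

Lemma smooth_extension (K : fieldType) (E H : coalgType K)
    (e : {linear E -> E}) (q : {linear E -> H}) :
  formally_smooth H -> (forall x, e (e x) = e x) -> tr_stable (ker e) ->
  (forall x, ker e x -> comul (q x) = tmap q q (comul x)) ->
  (forall x, counit (q x) = counit x) ->
  exists2 q' : {linear E -> H},
    forall x, ker e x -> q' x = q x &
    (forall x, counit (q' x) = counit x) /\
    forall x, wedge e x -> comul (q' x) = tmap q' q' (comul x).
Proof.
move=> smooth.
have surj (y : mho1 H) : exists t, y = mho1_proj t by exact: qpi_surj.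
have kerE (t : (H \ox H)%type) : mho1_proj t = 0 <-> exists h, t = comul h.
  split=> [|[h ->]]; last exact: mho1_proj_comul.
  rewrite -(linear0 (@mho1_proj K H)) => /qpi_eq; rewrite subr0 => tr.
  suff [h _ <-] : range (@comul K H) t by exists h.
  apply: Defs.span_sub tr => //; apply/is_submodP; split; first by exists 0; rewrite ?linear0.
  by move=> a _ _ [x _ <-] [y _ <-]; exists (a *: x + y); rewrite ?linearP.
exact: (injective_extension smooth surj kerE (@mho1_lcoactE K H) (@mho1_rcoactE K H)).
Qed.
(** * Restoring linearity *)

(* The Hopf algebra [H] enters only through its coalgebra structure, a bilinear
   product and the antipode, and [E] only as an [H]-module coalgebra. *)
Section ModuleCoalgebra.
Variables (K : fieldType) (H : coalgType K).
Variables (mul : H -> H -> H) (one : H) (S : {linear H -> H}).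
Hypothesis mul_l : forall y, linear (fun x => mul x y).
Hypothesis mul_r : forall x, linear (mul x).
Hypothesis mulA : forall x y z, mul x (mul y z) = mul (mul x y) z.
Hypothesis mul1 : forall x, mul one x = x.
Hypothesis mulx1 : forall x, mul x one = x.
Hypothesis comul_one : comul one = one \ox one.
Hypothesis comul_mul : forall x y, comul (mul x y) =
  tsum (fun a b => tsum (fun c d => mul a c \ox mul b d) (comul y)) (comul x).
Hypothesis counit_mul : forall x y, counit (mul x y) = (counit x : K) *: counit y.
Hypothesis antil : forall h,
  tsum (fun a b => mul (S a) b) (comul h) = (counit h : K) *: one.
Hypothesis antir : forall h,
  tsum (fun a b => mul a (S b)) (comul h) = (counit h : K) *: one.

Lemma mulZl a x y : mul (a *: x) y = a *: mul x y.
Proof. by rewrite -!(linE (mul_l y)) linearZ_LR. Qed.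

Lemma mulZr a x y : mul x (a *: y) = a *: mul x y.
Proof. by rewrite -!(linE (mul_r x)) linearZ_LR. Qed.

Lemma mulBr x y z : mul x (y - z) = mul x y - mul x z.
Proof. by rewrite -!(linE (mul_r x)) linearB. Qed.

Lemma tsum_mulr (U V : lmodType K) x (G : U -> V -> H) t :
  mul x (tsum G t) = tsum (fun u v => mul x (G u v)) t.
Proof. by rewrite -(linE (mul_r x)) linear_tsum; apply: eq_tsum => u v; rewrite linE. Qed.

Lemma tsum_mull (U V : lmodType K) x (G : U -> V -> H) t :
  mul (tsum G t) x = tsum (fun u v => mul (G u v) x) t.
Proof. by rewrite -(linE (mul_l x)) linear_tsum; apply: eq_tsum => u v; rewrite linE. Qed.

(** A left and a right convolution inverse of [k] agree, [f = f * (k * g) = (f * k) * g = g], in the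
    algebra of linear maps from [H \ox H] to [H], written as bilinear maps. *)
Lemma convolution_inverse_unique (f g k : H -> H -> H) :
  (forall y, linear (fun x => f x y)) -> (forall x, linear (f x)) ->
  (forall y, linear (fun x => g x y)) -> (forall x, linear (g x)) ->
  (forall y, linear (fun x => k x y)) -> (forall x, linear (k x)) ->
  (forall x y, tsum (fun a b => tsum (fun c d => mul (f a c) (k b d)) (comul y)) (comul x) =
     (counit x : K) *: ((counit y : K) *: one)) ->
  (forall x y, tsum (fun a b => tsum (fun c d => mul (k a c) (g b d)) (comul y)) (comul x) =
     (counit x : K) *: ((counit y : K) *: one)) ->
  forall x y, f x y = g x y.
Proof.
move=> fl fr gl gr kl kr fk kg x y.
pose Phi a c d := tsum (fun a' b' => tsum (fun c' d' => mul (mul (f a a') (k c c')) (g d d'))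
  (comul b')) (comul y).
have Phi1 c d : linear (fun a => Phi a c d) by rewrite /Phi; lin.
have Phi2 a d : linear (fun c => Phi a c d) by rewrite /Phi; lin.
have Phi3 a c : linear (fun d => Phi a c d) by rewrite /Phi; lin.
transitivity (tsum (fun a b => tsum (fun c d => Phi a c d) (comul b)) (comul x)).
  rewrite -[LHS](tsum_counitr (f := fun z => f z y)); last by lin.
  apply: eq_tsum => a b; rewrite tsum_exchange.
  rewrite -[f a y](tsum_counitr (f := f a)) -?tsumZ; last by lin.
  apply: eq_tsum => a' b'.
  transitivity (mul (f a a') (tsum (fun c d =>
      tsum (fun c' d' => mul (k c c') (g d d')) (comul b')) (comul b))).
    by rewrite kg !mulZr mulx1.
  rewrite tsum_mulr; apply: eq_tsum => c d; rewrite tsum_mulr.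
  by apply: eq_tsum => c' d'; rewrite mulA.
rewrite -(tsum_coassoc (F := Phi))//.
transitivity (tsum (fun a b =>
  tsum (fun a' b' => (counit a : K) *: ((counit a' : K) *: g b b')) (comul y)) (comul x)).
  apply: eq_tsum => a b; rewrite /Phi.
  under eq_tsum => c d.
    rewrite -(tsum_coassoc (F := fun a' c' d' => mul (mul (f c a') (k d c')) (g b d')));
      [|by lin..].
    over.
  rewrite tsum_exchange; apply: eq_tsum => a' b'.
  transitivity (mul (tsum (fun c d =>
      tsum (fun c' d' => mul (f c c') (k d d')) (comul a')) (comul a)) (g b b')).
    by rewrite tsum_mull; apply: eq_tsum => c d; rewrite tsum_mull.
  by rewrite fk !mulZl mul1.
under eq_tsum => a b do rewrite tsumZ tsum_counitl//.
by rewrite tsum_counitl.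
Qed.

(** The left side is a left, the right side a right convolution inverse of [mul]. *)
Lemma antipode_mul h k : S (mul h k) = mul (S k) (S h).
Proof.
apply: (convolution_inverse_unique (f := fun h k => S (mul h k))
  (g := fun h k => mul (S k) (S h)) (k := mul)) => [||||||x y|x y]; [by lin..| |].
  transitivity (tsum (fun a b => mul (S a) b) (comul (mul x y))); last first.
    by rewrite antil counit_mul scalerA.
  rewrite comul_mul tsum_tsum; last by lin.
  apply: eq_tsum => a b; rewrite tsum_tsum; last by lin.
  by apply: eq_tsum => c d; rewrite tsum_tensE//; lin.
transitivity (tsum (fun a b =>
  mul (mul a (tsum (fun c d => mul c (S d)) (comul y))) (S b)) (comul x)).
  apply: eq_tsum => a b; rewrite tsum_mulr tsum_mull.
  by apply: eq_tsum => c d; rewrite !mulA.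
rewrite antir.
transitivity (tsum (fun a b => (counit y : K) *: (mul a (S b))) (comul x)).
  by apply: eq_tsum => a b; rewrite mulZr mulx1 mulZl.
by rewrite tsumZ antir !scalerA mulrC.
Qed.

(** Regroups four Sweedler factors so that the two middle ones come from one [comul] and can be
    contracted. *)
Lemma tsum_coassoc4 (C : coalgType K) (W : lmodType K) (F : C -> C -> C -> C -> W) x :
  (forall b c d, linear (fun a => F a b c d)) -> (forall a c d, linear (fun b => F a b c d)) ->
  (forall a b d, linear (fun c => F a b c d)) -> (forall a b c, linear (fun d => F a b c d)) ->
  tsum (fun a b => tsum (fun c d => tsum (fun u v => F c d u v) (comul b)) (comul a)) (comul x) =
  tsum (fun c b => tsum (fun a v => tsum (fun d u => F c d u v) (comul a)) (comul b)) (comul x).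
Proof.
move=> F1 F2 F3 F4.
rewrite (tsum_coassoc (F := fun c d b => tsum (fun u v => F c d u v) (comul b))); [|by lin..].
apply: eq_tsum => c b.
by rewrite -(tsum_coassoc (F := fun d u v => F c d u v)); [|by lin..].
Qed.

Let tm (s t : (H \ox H)%type) : (H \ox H)%type :=
  tsum (fun a b => tsum (fun c d => mul a c \ox mul b d) t) s.

Let tm_l t : linear (fun s => tm s t). Proof. by rewrite /tm; lin. Qed.
Let tm_r s : linear (tm s). Proof. by rewrite /tm; lin. Qed.

Let tmA s t u : tm s (tm t u) = tm (tm s t) u.
Proof.
transitivity (tsum (fun a b => tsum (fun c d => tsum (fun f g =>
  mul a (mul c f) \ox mul b (mul d g)) u) t) s).
  apply: eq_tsum => a b; rewrite tsum_tsum; last by lin.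
  apply: eq_tsum => c d; rewrite tsum_tsum; last by lin.
  by apply: eq_tsum => f g; rewrite tsum_tensE//; lin.
rewrite /tm tsum_tsum; last by lin.
apply: eq_tsum => a b; rewrite tsum_tsum; last by lin.
apply: eq_tsum => c d; rewrite tsum_tensE; last by lin.
by apply: eq_tsum => f g; rewrite !mulA.
Qed.

Let tm1 k s : tm (((k : K) *: one) \ox one) s = k *: s.
Proof.
rewrite /tm tsum_tensE; last by lin.
rewrite -[s in RHS]tsum_tens -tsumZ; apply: eq_tsum => a b.
by rewrite mulZl !mul1 tensZl.
Qed.

Let tmx1 k s : tm s (((k : K) *: one) \ox one) = k *: s.
Proof.
rewrite /tm -[s in RHS]tsum_tens -tsumZ; apply: eq_tsum => a b.
by rewrite tsum_tensE ?mulZr ?mulx1 ?tensZl//; lin.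
Qed.

(** In the convolution algebra of maps from [H] to [H \ox H], the map [comul \o S] is a left inverse
    of [comul] by [L0], and the flipped [R] a right inverse by [R0]. *)
Lemma comul_antipode h : comul (S h) = tsum (fun a b => S b \ox S a) (comul h).
Proof.
pose R := tsum (fun a b => S b \ox S a).
have R_linear : linear R by rewrite /R; lin.
have R0 x : tsum (fun a b => tm (comul a) (R (comul b))) (comul x) =
    ((counit x : K) *: one) \ox one.
  transitivity (tsum (fun a b => tsum (fun c d => tsum (fun u v =>
      mul c (S v) \ox mul d (S u)) (comul b)) (comul a)) (comul x)).
    apply: eq_tsum => a b; apply: eq_tsum => c d.
    rewrite /R tsum_tsum; last by lin.
    by apply: eq_tsum => u v; rewrite tsum_tensE//; lin.
  rewrite (tsum_coassoc4 (F := fun c d u v => mul c (S v) \ox mul d (S u))); [|by lin..].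
  transitivity (tsum (fun c b => tsum (fun a v =>
      mul c (S ((counit a : K) *: v)) \ox one) (comul b)) (comul x)).
    apply: eq_tsum => c b; apply: eq_tsum => a v.
    by rewrite -tsum_tensr antir linearZ_LR mulZr tensZr tensZl.
  transitivity (tsum (fun c b => mul c (S b) \ox one) (comul x)).
    apply: eq_tsum => c b; rewrite -tsum_tensl -tsum_mulr -linear_tsum.
    by rewrite (tsum_counitl (f := id)).
  by rewrite -tsum_tensl antir.
have L0 x : tsum (fun a b => tm (comul (S a)) (comul b)) (comul x) =
    ((counit x : K) *: one) \ox one.
  transitivity (comul (tsum (fun a b => mul (S a) b) (comul x))).
    by rewrite linear_tsum; apply: eq_tsum => a b; rewrite comul_mul.
  by rewrite antil linearZ_LR comul_one tensZl.
transitivity (tsum (fun a b => tsum (fun c d => tm (comul (S a)) (tm (comul c) (R (comul d))))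
    (comul b)) (comul h)).
  rewrite -[LHS](tsum_counitr (f := fun z => comul (S z))); last by lin.
  apply: eq_tsum => a b.
  transitivity (tm (comul (S a)) (tsum (fun c d => tm (comul c) (R (comul d))) (comul b))).
    by rewrite R0 tmx1.
  by rewrite -(linE (tm_r _)) linear_tsum; apply: eq_tsum => c d; rewrite linE.
rewrite -(tsum_coassoc (F := fun a c d => tm (comul (S a)) (tm (comul c) (R (comul d)))));
  [|by lin..].
transitivity (tsum (fun a b => (counit a : K) *: R (comul b)) (comul h)); last first.
  by rewrite tsum_counitl//; lin.
apply: eq_tsum => a b.
transitivity (tm (tsum (fun c d => tm (comul (S c)) (comul d)) (comul a)) (R (comul b))).
  rewrite -(linE (tm_l _)) linear_tsum; apply: eq_tsum => c d.
  by rewrite linE tmA.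
by rewrite L0 tm1.
Qed.

(** * Coinvariants and the correction of the linearity defect *)

Variables (E : coalgType K) (act : H -> E -> E).
Hypothesis act_l : forall x, linear (fun h => act h x).
Hypothesis act_r : forall h, linear (act h).
Hypothesis act_mul : forall h k x, act (mul h k) x = act h (act k x).
Hypothesis act_one : forall x, act one x = x.
Hypothesis comul_act : forall h x, comul (act h x) =
  tsum (fun a b => tsum (fun c d => act a c \ox act b d) (comul x)) (comul h).
Hypothesis counit_act : forall h x, counit (act h x) = (counit h : K) *: counit x.

Variables (e : {linear E -> E}) (q : {linear E -> H}).
Hypothesis eK : forall x, e (e x) = e x.
Hypothesis ker_stable : tr_stable (ker e).
Hypothesis ker_act : forall h x, ker e x -> ker e (act h x).
Hypothesis q_comul : forall x, wedge e x -> comul (q x) = tmap q q (comul x).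
Hypothesis q_counit : forall x, counit (q x) = counit x.
Hypothesis q_act : forall h x, ker e x -> q (act h x) = mul h (q x).

Let wstable : tr_stable (wedge e) := wedge_stable eK ker_stable.

Lemma actZl a h x : act (a *: h) x = a *: act h x.
Proof. by rewrite -!(linE (act_l x)) linearZ_LR. Qed.

Lemma tsum_actl (U V : lmodType K) x (G : U -> V -> H) t :
  act (tsum G t) x = tsum (fun u v => act (G u v) x) t.
Proof. by rewrite -(linE (act_l x)) linear_tsum; apply: eq_tsum => u v; rewrite linE. Qed.

Lemma tsum_actr (U V : lmodType K) h (G : U -> V -> E) t :
  act h (tsum G t) = tsum (fun u v => act h (G u v)) t.
Proof. by rewrite -(linE (act_r h)) linear_tsum; apply: eq_tsum => u v; rewrite linE. Qed.

Lemma tsum_comul_act (W : lmodType K) (G : E -> E -> W) h x :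
  (forall b, linear (fun a => G a b)) -> (forall a, linear (G a)) ->
  tsum G (comul (act h x)) =
  tsum (fun a b => tsum (fun c d => G (act a c) (act b d)) (comul x)) (comul h).
Proof.
move=> Gl Gr; rewrite comul_act tsum_tsum; last by lin.
apply: eq_tsum => a b; rewrite tsum_tsum; last by lin.
by apply: eq_tsum => c d; rewrite tsum_tensE//; lin.
Qed.

Lemma wedge_act h x : wedge e x -> wedge e (act h x).
Proof.
move=> wx; rewrite /wedge /= -[comul _]tsum_tens linear_tsum /=.
rewrite tsum_comul_act; [|by lin..]; apply: big1 => p _.
apply: (wedge_tsum0 eK wx) => [b|a|a b ka|a b kb]; [by lin|by lin|..]; rewrite tmapE.
  by have := ker_act p.1 ka; rewrite /ker /= => ->; rewrite tens0l.
by have := ker_act p.2 kb; rewrite /ker /= => ->; rewrite tens0r.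
Qed.

(* On [wedge / ker], a left Hopf module over [H], the map [P] induces the
   projection [x |-> S(x_(-1)) x_0] onto the coinvariants. *)
Let P x : E := tsum (fun a b => act (S (q a)) b) (comul x).

Let P_linear : linear P. Proof. by rewrite /P; lin. Qed.

Let P_ker x : ker e x -> ker e (P x).
Proof.
move=> kx; rewrite /ker /P /= linear_tsum.
by apply: (stable_tsum0 ker_stable kx) => [b|a|a b _ kb]; [by lin|by lin|apply: ker_act].
Qed.

Let P_wedge x : wedge e x -> wedge e (P x).
Proof.
(* Presenting the wedge as a kernel turns membership into the vanishing of a Sweedler sum. *)
move=> wx; have [f De fK] := idempotent_ker (let: And3 M _ _ := wstable in M).
apply/De; rewrite /P linear_tsum.
apply: (stable_tsum0 wstable wx) => [b|a|a b _ wb]; [by lin|by lin|].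
by apply/De/wedge_act.
Qed.

(** Generation by coinvariants: [q] is comultiplicative on the wedge, so [q(x_1) S(q(x_2))]
    contracts to a counit. *)
Let decomposition x : wedge e x -> tsum (fun a b => act (q a) (P b)) (comul x) = x.
Proof.
move=> wx.
transitivity (tsum (fun a b => tsum (fun c d => act (q a) (act (S (q c)) d)) (comul b)) (comul x)).
  by apply: eq_tsum => a b; rewrite /P tsum_actr.
rewrite -(tsum_coassoc (F := fun a c d => act (q a) (act (S (q c)) d))); [|by lin..].
transitivity (tsum (fun a b => (counit a : K) *: b) (comul x)); last first.
  by rewrite (tsum_counitl (f := id)).
apply: (stable_eq_tsum wstable wx) => [b|a|b|a|a b wa _]; [by lin..|].
transitivity (act (tsum (fun c d => mul c (S d)) (tmap q q (comul a))) b).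
  rewrite tsum_tmap; [|by lin..]; rewrite tsum_actl.
  by apply: eq_tsum => c d; rewrite act_mul.
by rewrite -q_comul// antir q_counit actZl act_one.
Qed.

(** [q] may be treated as [H]-linear in [x_1]: it is so on [ker e], and terms with [x_2] in [ker e]
    die under [e]. Then [S(h_1 q(x_1)) h_2] contracts because [S] is antimultiplicative. *)
Let P_act h x : wedge e x -> e (P (act h x)) = (counit h : K) *: e (P x).
Proof.
move=> wx; rewrite /P tsum_comul_act; [|by lin..]; rewrite !linear_tsum.
transitivity (tsum (fun a b => tsum (fun c d => e (act (mul (S (q c)) (mul (S a) b)) d))
    (comul x)) (comul h)).
  apply: eq_tsum => a b; rewrite linear_tsum.
  apply: (wedge_eq_tsum eK wx) => [d|c|d|c|c d kc|c d kd]; [by lin..| |].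
    by rewrite q_act// antipode_mul -act_mul mulA.
  by have kab k : e (act k d) = 0; [exact: ker_act|rewrite -act_mul !kab].
rewrite tsum_exchange; apply: eq_tsum => c d /=.
transitivity (e (act (mul (S (q c)) (tsum (fun a b => mul (S a) b) (comul h))) d)).
  by rewrite tsum_mulr tsum_actl linear_tsum.
by rewrite antil mulZr mulx1 actZl linearZ_LR.
Qed.

(** [comul_antipode] reverses the factors of [S(q(x_1))], which brings [S(q(x_2))] next to [q(x_3)];
    this middle pair contracts to [one]. *)
Let P_coinvariant x : wedge e x ->
  tsum (fun a b => q a \ox e b) (comul (P x)) = one \ox e (P x).
Proof.
move=> wx; rewrite /P (linear_tsum comul) tsum_tsum; last by lin.
transitivity (tsum (fun a b => tsum (fun c d => tsum (fun u v =>
    mul (S d) (q u) \ox e (act (S c) v)) (comul b)) (comul (q a))) (comul x)).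
  apply: (stable_eq_tsum wstable wx) => [b|a|b|a|a b _ wb]; [by lin..|].
  rewrite tsum_comul_act; [|by lin..].
  rewrite comul_antipode tsum_tsum; last by lin.
  apply: eq_tsum => c d; rewrite tsum_tensE; last by lin.
  apply: (wedge_eq_tsum eK wb) => [v|u|v|u|u v ku|u v kv]; [by lin..| |].
    by rewrite q_act.
  by have kab k : e (act k v) = 0; [exact: ker_act|rewrite kab !tens0r].
transitivity (tsum (fun a b => tsum (fun c d => tsum (fun u v =>
    mul (S (q d)) (q u) \ox e (act (S (q c)) v)) (comul b)) (comul a)) (comul x)).
  apply: (stable_eq_tsum wstable wx) => [b|a|b|a|a b wa _]; [by lin..|].
  by rewrite q_comul// tsum_tmap; [|by lin..].
rewrite (tsum_coassoc4 (F := fun c d u v => mul (S (q d)) (q u) \ox e (act (S (q c)) v)));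
  [|by lin..].
rewrite linear_tsum tsum_tensr.
apply: (stable_eq_tsum wstable wx) => [b|a|b|a|a b _ wb]; [by lin..|].
transitivity (tsum (fun c d =>
  one \ox e (act (S (q a)) ((counit c : K) *: d))) (comul b)); last first.
  rewrite -tsum_tensr -linear_tsum -tsum_actr.
  by rewrite (tsum_counitl (f := id)).
apply: (stable_eq_tsum wstable wb) => [d|c|d|c|c d wc _]; [by lin..|].
rewrite -tsum_tensl.
transitivity (tsum (fun u v => mul (S u) v) (tmap q q (comul c)) \ox e (act (S (q a)) d)).
  by rewrite tsum_tmap; [|by lin..].
rewrite -q_comul// antil q_counit -[in RHS](linE (act_r _)) !linearZ_LR linE.
by rewrite tensZl tensZr.
Qed.

(* The defect of [H]-linearity of [q], which only depends on [x] modulo [ker]. *)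
Let d h x : H := q (act h x) - mul h (q x).

Let d_l x : linear (fun h => d h x). Proof. by rewrite /d; lin. Qed.
Let d_r h : linear (d h). Proof. by rewrite /d; lin. Qed.

Let dZl a h x : d (a *: h) x = a *: d h x.
Proof. by rewrite -!(linE (d_l x)) linearZ_LR. Qed.

Let dZr a h x : d h (a *: x) = a *: d h x.
Proof. by rewrite -!(linE (d_r h)) linearZ_LR. Qed.

Let d_ker h x : ker e x -> d h x = 0.
Proof. by move=> kx; rewrite /d q_act// subrr. Qed.

Let d_mod h x y : e x = e y -> d h x = d h y.
Proof.
move=> exy; apply/eqP; rewrite -subr_eq0 -!(linE (d_r h)) -linearB linE.
by rewrite d_ker// /ker /= linearB exy subrr.
Qed.

Let d_one x : d one x = 0.
Proof. by rewrite /d act_one mul1 subrr. Qed.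

(** The cocycle identity behind [mu_act]. *)
Let d_mul h k x : d (mul h k) x = d h (act k x) + mul h (d k x).
Proof.
by rewrite /d mulBr act_mul mulA addrA subrK.
Qed.

Let mu x : H := tsum (fun a b => d (q a) (P b)) (comul x).

Let mu_linear : linear mu. Proof. by rewrite /mu; lin. Qed.

Let mu_ker x : ker e x -> mu x = 0.
Proof.
move=> kx; apply: (stable_tsum0 ker_stable kx) => [b|a|a b _ kb]; [by lin|by lin|].
by rewrite d_ker//; apply: P_ker.
Qed.

Let counit_mu x : counit (mu x) = 0.
Proof.
rewrite /mu linear_tsum; apply: big1 => p _.
by rewrite /d linearB /= counit_mul !q_counit counit_act q_counit subrr.
Qed.

(** As [d] ignores [ker e], [P_act] reduces [h_2] to a counit and leaves [d (h q(x_1)) (P x_2)];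
    [d_mul] splits this, and [decomposition] reassembles [x] in the first part. *)
Let mu_act h x : wedge e x -> mu (act h x) = d h x + mul h (mu x).
Proof.
move=> wx; rewrite /mu tsum_comul_act; [|by lin..].
transitivity (tsum (fun a b => tsum (fun c d' => d (mul ((counit b : K) *: a) (q c)) (P d'))
    (comul x)) (comul h)).
  apply: eq_tsum => a b.
  transitivity (tsum (fun c d' => d (mul a (q c)) (P (act b d'))) (comul x)).
    apply: (wedge_eq_tsum eK wx) => [v|u|v|u|u v ku|u v kv]; [by lin..| |].
      by rewrite q_act.
    by rewrite !d_ker//; apply: P_ker; apply: ker_act.
  apply: (stable_eq_tsum wstable wx) => [v|u|v|u|u v _ wv]; [by lin..|].
  rewrite mulZl dZl -dZr; apply: d_mod.
  by rewrite P_act// linearZ_LR.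
rewrite tsum_exchange.
transitivity (tsum (fun c d' => d h (act (q c) (P d')) + mul h (d (q c) (P d'))) (comul x)).
  apply: eq_tsum => c d'; rewrite -d_mul.
  by rewrite -[in RHS](tsum_counitr (f := id) h)// tsum_mull -(linE (d_l _)) linear_tsum;
    apply: eq_tsum => a b; rewrite linE.
rewrite tsumD -tsum_mulr; congr (_ + _).
rewrite -[in RHS](decomposition wx) -(linE (d_r h)) linear_tsum.
by apply: eq_tsum => a b; rewrite linE.
Qed.

Let qt_subproof : linear (fun x => q x - mu x). Proof. by lin. Qed.
Let qt : {linear E -> H} := lin qt_subproof.

Let qtE x : qt x = q x - mu x. Proof. exact: linE. Qed.

Let qt_act h x : wedge e x -> qt (act h x) = mul h (qt x).
Proof. by move=> wx; rewrite !qtE mu_act// mulBr /d opprD addrA subKr. Qed.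

(** [G] sees its second argument only modulo [ker e], where the coaction on [P x] is trivial. *)
Let coinvariant_eval (W : lmodType K) (G : H -> E -> W) x :
  wedge e x -> (forall y, linear (fun h => G h y)) -> (forall h, linear (G h)) ->
  (forall h y, ker e y -> G h y = 0) ->
  tsum (fun a b => G (q a) b) (comul (P x)) = G one (P x).
Proof.
move=> wx Gl Gr G0.
have Ge h y : G h (e y) = G h y.
  apply/eqP; rewrite -subr_eq0 -!(linE (Gr h)) -linearB linE.
  by apply/eqP/G0; rewrite /ker /= linearB eK subrr.
transitivity (tsum G (one \ox e (P x))); last by rewrite tsum_tensE ?Ge//; lin.
rewrite -P_coinvariant// tsum_tsum; last by lin.
by apply: eq_tsum => a b; rewrite tsum_tensE ?Ge//; lin.
Qed.

Let mu_P x : wedge e x -> mu (P x) = 0.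
Proof.
move=> wx; rewrite -[RHS](d_one (P (P x))).
apply: (coinvariant_eval (G := fun h y => d h (P y)) wx) => [y|h|h y ky]; [by lin|by lin|].
by rewrite d_ker//; apply: P_ker.
Qed.

(** On [P x] the correction [mu] vanishes, and so do all terms of [comul (P x)] that involve it: two
    by coinvariance, the quadratic one on the wedge. *)
Let comul_qt_P x : wedge e x -> comul (qt (P x)) = tmap qt qt (comul (P x)).
Proof.
move=> wx; have wPx := P_wedge wx.
rewrite [qt (P x)]qtE mu_P// subr0 q_comul//.
have qmu : tsum (fun a b => q a \ox mu b) (comul (P x)) = 0.
  rewrite -[RHS](tens0r _ one) -(mu_P wx).
  apply: (coinvariant_eval (G := fun h y => h \ox mu y) wx) => [y|h|h y ky]; [by lin|by lin|].
  by rewrite mu_ker// tens0r.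
have muq : tsum (fun a b => mu a \ox q b) (comul (P x)) = 0.
  (* Coassociativity moves [P] into the right factor, so that coinvariance can replace [q a] by
     [one]. *)
  transitivity (tsum (fun a b => tsum (fun u v => d (q a) (P u) \ox q v) (comul b)) (comul (P x))).
    rewrite -(tsum_coassoc (F := fun a u v => d (q a) (P u) \ox q v)); [|by lin..].
    by apply: eq_tsum => a b; rewrite /mu tsum_tensl.
  transitivity (tsum (fun u v => d one (P u) \ox q v) (comul (P x))).
    apply: (coinvariant_eval (G := fun h y => tsum (fun u v => d h (P u) \ox q v) (comul y)) wx)
      => [y|h|h y ky]; [by lin|by lin|].
    apply: (stable_tsum0 ker_stable ky) => [b|a|a b ka _]; [by lin|by lin|].
    by rewrite d_ker ?tens0l//; apply: P_ker.
  by apply: big1 => p _; rewrite d_one tens0l.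
have mumu : tsum (fun a b => mu a \ox mu b) (comul (P x)) = 0.
  apply: (wedge_tsum0 eK wPx) => [b|a|a b ka|a b kb]; [by lin|by lin|..].
    by rewrite (mu_ker ka) tens0l.
  by rewrite (mu_ker kb) tens0r.
transitivity (tsum (fun a b => q a \ox q b) (comul (P x))
   - tsum (fun a b => q a \ox mu b) (comul (P x))
   - tsum (fun a b => mu a \ox q b) (comul (P x))
   + tsum (fun a b => mu a \ox mu b) (comul (P x))).
  rewrite qmu muq mumu !subr0 addr0.
  by move: (comul (P x)); apply: tens_ext => [||a b]; [by lin..|]; rewrite tmapE tsum_tensE//; lin.
rewrite -!tsumB -tsumD [RHS]tmap_tsum; apply: eq_tsum => a b.
by rewrite !qtE tensBl !tensBr opprD opprK !addrA.
Qed.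

Let comul_qt_act h x : wedge e x -> comul (qt x) = tmap qt qt (comul x) ->
  comul (qt (act h x)) = tmap qt qt (comul (act h x)).
Proof.
move=> wx cx; rewrite qt_act// comul_mul cx.
rewrite [RHS]tmap_tsum tsum_comul_act; [|by lin..]; apply: eq_tsum => a b.
rewrite tsum_tmap; [|by lin..].
apply: (stable_eq_tsum wstable wx) => [v|u|v|u|u v wu wv]; [by lin..|].
by rewrite !qt_act.
Qed.

(** By [decomposition] it suffices to treat [act h (P x)], where the linearity of [qt] transports
    [comul_qt_P]. *)
Let comul_qt x : wedge e x -> comul (qt x) = tmap qt qt (comul x).
Proof.
move=> wx; rewrite -(decomposition wx) !linear_tsum.
apply: (stable_eq_tsum wstable wx) => [v|u|v|u|u v _ wv]; [by lin..|].
by apply: comul_qt_act; [apply: P_wedge|apply: comul_qt_P].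
Qed.

Lemma linearized_extension : exists2 q' : {linear E -> H},
  forall x, ker e x -> q' x = q x &
  [/\ forall x, counit (q' x) = counit x,
      forall x, wedge e x -> comul (q' x) = tmap q' q' (comul x) &
      forall h x, wedge e x -> q' (act h x) = mul h (q' x)].
Proof.
exists qt => [x kx|]; first by rewrite qtE mu_ker// subr0.
by split=> // x; rewrite qtE linearB /= counit_mu subr0.
Qed.

End ModuleCoalgebra.
Lemma tmul_tsum (K : fieldType) (A : algType K) (s t : (A \ox A)%type) :
  tmul s t = tsum (fun a b => tsum (fun c d => (a * c) \ox (b * d)) t) s.
Proof.
rewrite /tmul tsumE /=; apply: eq_tsum => a b.
by rewrite tliftE tsumE /=; apply: eq_tsum => c d; rewrite tliftE.
Qed.

(** * The extension step for a Hopf subalgebra *)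

Section HopfExtension.
Variables (K : fieldType) (E : bialgType K) (P : pred E) (H : subHopfAlgType P).

Let iota : {linear H -> E} := val.

Let iota_mul_l x : linear (fun h : H => iota h * x).
Proof. by move=> a h k; rewrite linearP mulrDl scalerAl. Qed.

Let iota_mul_r h : linear (fun x : E => iota h * x).
Proof. by move=> a x y; rewrite mulrDr scalerAr. Qed.

Let comul_iota_mul (h : H) (x : E) : comul (iota h * x) =
  tsum (fun a b => tsum (fun c d : E => (iota a * c) \ox (iota b * d)) (comul x)) (comul h).
Proof.
have [valC _] := @val_coalg_morphism K E P H.
by rewrite comulM tmul_tsum valC tsum_tmap//; lin.
Qed.

Lemma wedge_val_mul (e : {linear E -> E}) (h : H) x : (forall x, e (e x) = e x) ->
  (forall (h : H) x, ker e x -> ker e (val h * x)) ->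
  wedge e x -> wedge e (val h * x).
Proof. by move=> eK ka; apply: (wedge_act iota_mul_r comul_iota_mul eK ka). Qed.

Lemma hopf_extension (e : {linear E -> E}) (q : {linear E -> H}) :
  formally_smooth H -> (forall x, e (e x) = e x) -> tr_stable (ker e) ->
  (forall (h : H) x, ker e x -> ker e (val h * x)) ->
  (forall x, ker e x -> comul (q x) = tmap q q (comul x)) ->
  (forall x, counit (q x) = counit x) ->
  (forall (h : H) x, ker e x -> q (val h * x) = h * q x) ->
  exists2 q' : {linear E -> H},
  forall x, ker e x -> q' x = q x &
  [/\ forall x, counit (q' x) = counit x,
      forall x, wedge e x -> comul (q' x) = tmap q' q' (comul x) &
      forall (h : H) x, wedge e x -> q' (val h * x) = h * q' x].
Proof.
move=> smooth eK ke ka qm qe qa.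
have [q1 q1q [q1e q1m]] := smooth_extension smooth eK ke qm qe.
have q1a (h : H) x : ker e x -> q1 (val h * x) = h * q1 x.
  by move=> kx; rewrite !q1q ?qa//; apply: ka.
suff [q' q'q q'P] : exists2 q' : {linear E -> H},
  forall x, ker e x -> q' x = q1 x &
  [/\ forall x, counit (q' x) = counit x,
      forall x, wedge e x -> comul (q' x) = tmap q' q' (comul x) &
      forall (h : H) x, wedge e x -> q' (val h * x) = h * q' x].
  by exists q' => // x kx; rewrite q'q ?q1q.
have [_ valE] := @val_coalg_morphism K E P H.
have mL y : linear (fun x : H => x * y) by move=> a h k; rewrite mulrDl scalerAl.
have mR y : linear (fun x : H => y * x) by move=> a h k; rewrite mulrDr scalerAr.
have cM (x y : H) : comul (x * y) =
    tsum (fun a b => tsum (fun c d : H => (a * c) \ox (b * d)) (comul y)) (comul x).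
  by rewrite comulM tmul_tsum.
have antl (h : H) : tsum (fun a b : H => antipode a * b) (comul h) = (counit h : K) *: 1.
  rewrite -[RHS]antipodel; move: (comul h); apply: tens_ext => [||a b]; [by lin..|].
  by rewrite tmapE tprodE tsum_tensE//; lin.
have antr (h : H) : tsum (fun a b : H => a * antipode b) (comul h) = (counit h : K) *: 1.
  rewrite -[RHS]antipoder; move: (comul h); apply: tens_ext => [||a b]; [by lin..|].
  by rewrite tmapE tprodE tsum_tensE//; lin.
have aM (h k : H) (x : E) : iota (h * k) * x = iota h * (iota k * x).
  by rewrite rmorphM mulrA.
have a1 (x : E) : iota 1 * x = x by rewrite rmorph1 mul1r.
have aE (h : H) (x : E) : counit (iota h * x) = (counit h : K) *: counit x.
  by rewrite counitM valE.
have mE (h k : H) : counit (h * k) = (counit h : K) *: counit k by rewrite counitM.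
have c1 : comul (1 : H) = 1 \ox 1 := comul1.
have mA (x y z : H) : x * (y * z) = x * y * z by rewrite mulrA.
have m1 (x : H) : 1 * x = x by rewrite mul1r.
have mx1 (x : H) : x * 1 = x by rewrite mulr1.
exact: (linearized_extension mL mR mA m1 mx1 c1 cM mE antl antr
  iota_mul_l iota_mul_r aM a1 comul_iota_mul aE
  eK ke ka q1m q1e q1a).
Qed.
End HopfExtension.
(** * Maximal partial weak projections *)

Section PartialProjections.
Variables (K : fieldType) (E : bialgType K) (P : pred E) (H : subHopfAlgType P).
Implicit Type G : set (E * H).

(** If [G] is the graph of [q], these pairs span the graph of [q \ox q] on the tensor square of its
    domain. Being monotone in [G], this form of comultiplicativity passes to unions. *)
Definition graph_tens G : set ((E \ox E)%type * (H \ox H)%type) :=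
  [set t | exists u v, [/\ G u, G v & t = (u.1 \ox v.1, u.2 \ox v.2)]].

(* The graph of a weak projection defined on a subcoalgebra of [E]; all the
   conditions are preserved by unions of chains. *)
Record partial_projection G : Prop := PartialProjection {
  pp_submod : is_submod G;
  pp_single : single_valued G;
  pp_val : forall h : H, G (val h, h);
  pp_act : forall (h : H) u, G u -> G (val h * u.1, h * u.2);
  pp_comul : forall u, G u -> Defs.span (graph_tens G) (comul u.1, comul u.2);
  pp_counit : forall u, G u -> counit u.2 = counit u.1
}.

Lemma graph_tens_mono G G' : G `<=` G' ->
  Defs.span (graph_tens G) `<=` Defs.span (graph_tens G').
Proof.
move=> GG'; apply: Defs.span_sub; first exact: span_submod.
by move=> _ [u [v [Gu Gv ->]]]; apply: Defs.sub_span; exists u, v; split=> //; apply: GG'.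
Qed.

Lemma val_partial_projection : partial_projection [set u | u.1 = val u.2].
Proof.
have [valC valE] := @val_coalg_morphism K E P H.
split=> //=.
- apply/is_submodP; split=> /=; first by rewrite linear0.
  by move=> a [x h] [y k] /= -> ->; rewrite linearP.
- move=> h /esym e0; apply: val_inj; rewrite /= e0; exact/esym/linear0.
- by move=> h u ->; rewrite rmorphM.
- move=> [x h] /= ->; rewrite valC.
  pose T : set (H \ox H)%type := [set t |
    Defs.span (graph_tens [set u | u.1 = val u.2]) (tmap val val t, t)].
  suff : T (comul h) by [].
  have /is_submodP[S0 SZ] := Defs.span_submod (graph_tens [set u : E * H | u.1 = val u.2]).
  elim/tens_ind: (comul h) => [a b|s t Ts Tt].
    by rewrite /T /= tmapE; apply: Defs.sub_span; exists (val a, a), (val b, b).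
  by have := SZ 1 _ _ Ts Tt; rewrite scale1r /T /= linearD.
- by move=> u ->; rewrite valE.
Qed.

Lemma partial_projection_max : exists2 G, partial_projection G &
  forall G', partial_projection G' -> G `<=` G' -> G' = G.
Proof.
pose Q G := G = set0 \/ partial_projection G.
have [F FQ Ftot|G [QG Gmax]] := @Zorn_bigcup _ Q.
  have [F0|/existsNP[G0 /not_implyP[FG0 nG0]]] :=
      pselect (forall G, F G -> G = set0).
    by left; apply/seteqP; split=> // u [X /F0 ->].
  have G0p : partial_projection G0 by case: (FQ _ FG0).
  have U u : (\bigcup_(X in F) X) u -> exists X, [/\ F X, partial_projection X & X u].
    by move=> [X FX Xu]; exists X; split=> //; case: (FQ _ FX) Xu => [->|].
  have sub X : F X -> X `<=` \bigcup_(X in F) X by move=> FX u Xu; exists X.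
  right; split.
  - have /is_submodP[G00 _] := pp_submod G0p.
    apply/is_submodP; split; first by exists G0.
    move=> a u v /U[X [FX Xp Xu]] /U[Y [FY Yp Yv]].
    have /is_submodP[_ XZ] := pp_submod Xp; have /is_submodP[_ YZ] := pp_submod Yp.
    by have [XY|YX] := Ftot _ _ FX FY; [exists Y => //; apply: YZ => //; apply: XY|
      exists X => //; apply: XZ => //; apply: YX].
  - by move=> y /U[X [_ Xp Xy]]; apply: pp_single Xp _ Xy.
  - by move=> h; exists G0 => //; apply: pp_val.
  - by move=> h u /U[X [FX Xp Xu]]; exists X => //; apply: pp_act.
  - move=> u /U[X [FX Xp Xu]].
    by apply: graph_tens_mono (pp_comul Xp Xu); apply: sub.
  - by move=> u /U[X [FX Xp Xu]]; apply: pp_counit Xp _ Xu.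
have Gp : partial_projection G.
  case: QG => // G0; case: (Gmax [set u | u.1 = val u.2]).
    rewrite G0; split=> [//|]; move=> /(_ (0, 0)); apply => /=; exact/esym/linear0.
  by right; apply: val_partial_projection.
exists G => // G' G'p GG'; apply: contrapT => G'G.
apply: (Gmax G'); last by right.
by split=> // G'G'; apply: G'G; apply/seteqP.
Qed.

Lemma partial_projection_extend G (e : {linear E -> E}) : formally_smooth H ->
  partial_projection G -> (forall x, e (e x) = e x) ->
  (forall x, ker e x <-> exists y, G (x, y)) ->
  tr_stable (ker e) /\
  exists2 G', partial_projection G' & G `<=` G' /\
    forall x, wedge e x -> exists y, G' (x, y).
Proof.
move=> smooth Gp eK kG.
have [q0 q0G] := total_extension (pp_submod Gp) (pp_single Gp).
(* Off the domain of [G] the map [q0] is arbitrary; this multiple of [1] makes it counital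
   everywhere and vanishes on that domain. *)
have qL : linear (fun x => q0 x + ((counit x - counit (q0 x) : K^o) : K) *: 1) by lin.
pose q : {linear E -> H} := lin qL.
have qG x y : G (x, y) -> q x = y.
  by move=> Gxy; rewrite linE (q0G _ _ Gxy) (pp_counit Gp Gxy) subrr scale0r addr0.
have Gq x : ker e x -> G (x, q x).
  by move=> /kG[y Gxy]; rewrite (qG _ _ Gxy).
have qe x : counit (q x) = counit x.
  by rewrite linE linearD /= (linearZ_LR counit) counit1 [_ *: _]mulr1 addrC subrK.
have qm x : ker e x -> comul (q x) = tmap q q (comul x).
  move=> /Gq /(pp_comul Gp) /=.
  pose T : set ((E \ox E)%type * (H \ox H)%type) := [set t | t.2 = tmap q q t.1].
  suff h : Defs.span (graph_tens G) `<=` T by move=> /h.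
  apply: Defs.span_sub => [|_ [[a a'] [[b b'] [Ga Gb ->]]]].
    apply/is_submodP; split; first by rewrite /T /= linear0.
    by move=> a s t; rewrite /T /= linearP => -> ->.
  by rewrite /T /= tmapE (qG _ _ Ga) (qG _ _ Gb).
have ka (h : H) x : ker e x -> ker e (val h * x).
  by move=> /Gq /(pp_act Gp h) /= Ghx; apply/kG; exists (h * q x).
have qa (h : H) x : ker e x -> q (val h * x) = h * q x.
  by move=> /Gq /(pp_act Gp h) /= /qG.
have ks : tr_stable (ker e).
  apply/subcoalgebraP; split.
    apply/is_submodP; split; first by rewrite /ker /= linear0.
    by move=> a x y; rewrite /ker /= linearP => -> ->; rewrite scaler0 addr0.
  move=> x /Gq /(pp_comul Gp) /=.
  pose T : set ((E \ox E)%type * (H \ox H)%type) :=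
    [set t | Defs.span [set y \ox z | y in ker e & z in ker e] t.1].
  suff h : Defs.span (graph_tens G) `<=` T by move=> /h.
  apply: Defs.span_sub => [|_ [[a a'] [[b b'] [Ga Gb ->]]]].
    have /is_submodP[S0 SZ] := Defs.span_submod [set y \ox z | y in ker e & z in ker e].
    by apply/is_submodP; split=> // c s t; apply: SZ.
  by apply: Defs.sub_span; exists a; [apply/kG; exists a'|exists b => //; apply/kG; exists b'].
split=> //; have [q' q'q [q'e q'm q'a]] := hopf_extension smooth eK ks ka qm qe qa.
have ws := wedge_stable eK ks.
exists [set u | wedge e u.1 /\ u.2 = q' u.1]; last first.
  split=> [[x y] Gxy|x wx]; last by exists (q' x).
  have kx : ker e x by apply/kG; exists y.
  by split=> /=; [apply: ker_wedge|rewrite q'q// (qG _ _ Gxy)].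
split.
- case: ws => /is_submodP[w0 wZ] _ _; apply/is_submodP; split=> /=.
    by split=> //; rewrite linear0.
  by move=> a [x y] [x' y'] /= [wx ->] [wx' ->]; split; [apply: wZ|rewrite linearP].
- by move=> y [_ /= ->]; rewrite linear0.
- move=> h; have kh : ker e (val h) by apply/kG; exists h; apply: pp_val.
  by split=> /=; [apply: ker_wedge|rewrite q'q// (qG _ _ (pp_val Gp h))].
- move=> h [x y] /= [wx ->]; split; last by rewrite q'a.
  exact: wedge_val_mul eK ka wx.
- move=> [x y] /= [wx ->]; rewrite q'm//.
  have [_ /(_ _ wx)] := (subcoalgebraP _).2 ws.
  set G' := (X in graph_tens X).
  pose T : set (E \ox E)%type := [set t | Defs.span (graph_tens G') (t, tmap q' q' t)].
  suff h : Defs.span [set y \ox z | y in wedge e & z in wedge e] `<=` T by move=> /h.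
  have /is_submodP[S0 SZ] := Defs.span_submod (graph_tens G').
  apply: Defs.span_sub => [|_ [a wa [b wb <-]]].
    apply/is_submodP; split; first by rewrite /T /= linear0.
    by move=> c s t Ts Tt; rewrite /T /= linearP; apply: (SZ c (_, _) (_, _)).
  rewrite /T /= tmapE; apply: Defs.sub_span.
  by exists (a, q' a), (b, q' b).
- by move=> [x y] /= [wx ->]; rewrite q'e.
Qed.

End PartialProjections.

Theorem theorem9p16 (K : fieldType) (E : bialgType K) (P : pred E)
    (H : subHopfAlgType P)
    (H_smooth : formally_smooth H)
    (corad_sub : corad E `<=` [set x : E | P x]) :
  exists p : {linear E -> H}, weak_projection p.
Proof.
have [G Gp Gmax] := partial_projection_max H.
have [e De eK] : exists2 e : {linear E -> E},
    forall x, (exists y, G (x, y)) <-> e x = 0 & forall x, e (e x) = e x.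
  apply: (@idempotent_ker K E [set x | exists y, G (x, y)]).
  have /is_submodP[G0 GZ] := pp_submod Gp.
  apply/is_submodP; split; first by exists 0.
  by move=> a x x' [y Gy] [y' Gy']; exists (a *: y + y'); apply: (GZ a (x, y) (x', y')).
have kG x : ker e x <-> exists y, G (x, y) by split=> /De.
have [ks [G' G'p [GG' wG']]] := partial_projection_extend H_smooth Gp eK kG.
(* By maximality the domain of [G] contains its own wedge; containing the coradical as well, it is
   all of [E]. *)
rewrite (Gmax _ G'p GG') in wG'.
have dom x : exists y, G (x, y).
  apply/kG; apply: (@wedge_closed_full K E (ker e) e ks) => // [y /corad_sub Py|y wy].
    by apply/kG; exists (Sub y Py); rewrite -[y in (y, _)](@SubK _ _ H _ Py); apply: pp_val.
  exact/kG/wG'.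
have [p pG] := total_extension (pp_submod Gp) (pp_single Gp).
have Gpx x : G (x, p x) by have [y Gy] := dom x; rewrite (pG _ _ Gy).
exists p; split=> [h|h x|].
- by apply: pG; apply: pp_val.
- by apply: pG; apply: (pp_act Gp h (Gpx x)).
split=> x; last exact: pp_counit Gp _ (Gpx x).
have := pp_comul Gp (Gpx x).
pose T : set ((E \ox E)%type * (H \ox H)%type) := [set t | t.2 = tmap p p t.1].
suff h : Defs.span (graph_tens G) `<=` T by move=> /h.
apply: Defs.span_sub => [|_ [[a a'] [[b b'] [Ga Gb ->]]]].
  apply/is_submodP; split; first by rewrite /T /= linear0.
  by move=> a s t; rewrite /T /= linearP => -> ->.
by rewrite /T /= tmapE (pG _ _ Ga) (pG _ _ Gb).
Qed.
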